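(* Let $\alpha>0$, $T>0$ and $\beta\in[0,1]\setminus\{\frac12-\frac{\sqrt6}6,\frac12+\frac{\sqrt6}6\}$. Let $e_N=\widehat X^N_{N,1}-X^1_T$ be the error of the symplectic $\beta$ method with step-size $h=T/N$ for the linear stochastic oscillator. Then, as $N\to\infty$, $$\mathrm{Var}(e_N)=(3\beta^2-3\beta+1)\Big(\frac{\alpha^2}{6}T+\frac{\alpha^2}{12}\sin(2T)\Big)h^2+\mathcal{O}(h^3),$$ and $Ne_N-\mathbb{E}[Ne_N]$ converges in distribution to $$\mathcal{N}\Big(0,\alpha^2T^2(3\beta^2-3\beta+1)\Big(\frac T6+\frac{\sin(2T)}{12}\Big)\Big).$$
   Context: Linear stochastic oscillator: $\mathrm{d}X_t=\begin{pmatrix}0&1\\-1&0\end{pmatrix}X_t\,\mathrm{d}t+\alpha\begin{pmatrix}0\\1\end{pmatrix}\mathrm{d}W_t$, $t\in[0,T]$, $X_t=(X^1_t,X^2_t)^\top$, with deterministic $X_0=(X^1_0,X^2_0)^\top\in\mathbb{R}^2$ and $W$ a one-dimensional standard Brownian motion. The symplectic $\beta$ method is $(\widehat X^N_{k+1,1},\widehat X^N_{k+1,2})^\top=A_\beta(\widehat X^N_{k,1},\widehat X^N_{k,2})^\top+\alpha b_\beta(W_{(k+1)h}-W_{kh})$, $k=0,\dots,N-1$, $(\widehat X^N_{0,1},\widehat X^N_{0,2})^\top=X_0$, with $h=T/N$ and $$A_\beta=\frac1{1+\beta(1-\beta)h^2}\begin{pmatrix}1-(1-\beta)^2h^2&h\\-h&1-\beta^2h^2\end{pmatrix},\qquad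 b_\beta=\frac1{1+\beta(1-\beta)h^2}\begin{pmatrix}(1-\beta)h\\1\end{pmatrix}.$$ $\mathcal{O}(h^3)$ denotes a quantity bounded by $Ch^3$ for all sufficiently small $h$, with $C$ independent of $h$ ($T,\alpha,\beta$ fixed). $\mathcal{N}(\mathbf m,\Sigma)$ is the normal law with mean $\mathbf m$ and variance $\Sigma$. *)

(* Defs.v *)
From HB Require Import structures.
From mathcomp Require Import all_boot all_order all_algebra.
From mathcomp Require Import all_classical all_reals all_analysis.

Set Implicit Arguments.
Unset Strict Implicit.
Unset Printing Implicit Defensive.

Import Order.TTheory GRing.Theory Num.Theory.
Import numFieldNormedType.Exports.

Local Open Scope classical_set_scope.
Local Open Scope ring_scope.

Definition col2 (R : realType) (a b : R) : 'cV[R]_2 :=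
  \col_(i < 2) (if i == 0 then a else b).

Definition mx2 (R : realType) (a b c d : R) : 'M[R]_2 :=
  \matrix_(i < 2, j < 2)
    (if i == 0 then (if j == 0 then a else b) else (if j == 0 then c else d)).

(* [normal_prob] takes the standard deviation; here [v] is the variance.
   Meaningful for [0 < v] only: [normal_prob m 0] is not a Dirac mass. *)
Definition normal_law (R : realType) (m v : R) : probability (measurableTypeR R) R :=
  normal_prob m (Num.sqrt v).

Section Processes.
Context (R : realType) (d : measure_display) (Omega : measurableType d).
Variable P : probability Omega R.

Definition increment (W : R -> {RV P >-> R}) (s t : R) : Omega -> R :=
  fun w => W t w - W s w.

(* Taking some of the [B i] to be [setT] gives the product rule for every
   subfamily, so this is mutual independence of the [n] increments. *)
Definition independent_increments (T : R) (W : R -> {RV P >-> R}) : Prop :=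
  forall (n : nat) (t : nat -> R),
    (forall i, (i <= n)%N -> 0 <= t i <= T) ->
    (forall i, (i < n)%N -> t i <= t i.+1) ->
    forall B : 'I_n -> set R, (forall i, measurable (B i)) ->
      P (\bigcap_(i in [set: 'I_n]) (increment W (t i) (t i.+1) @^-1` B i)) =
      (\prod_(i < n) P (increment W (t i) (t i.+1) @^-1` B i))%E.

(* Standard Brownian motion on [0, T]; values outside [0, T] are ignored. *)
Definition brownian_motion (T : R) (W : R -> {RV P >-> R}) : Prop :=
  [/\ {ae P, forall w, W 0 w = 0},
      independent_increments T W,
      forall s t : R, 0 <= s -> s < t -> t <= T ->
        forall B : set R, measurable B ->
          P (increment W s t @^-1` B) = normal_law 0 (t - s) B &
      {ae P, forall w, {within `[0, T], continuous (fun t : R => W t w)}}].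

Definition oscillator_drift : 'M[R]_2 := mx2 0 1 (-1) 0.

(* The noise coefficient is constant, so the stochastic integral of
   [alpha * col2 0 1] over [0, t] is [alpha * col2 0 1] times [W t - W 0]. *)
Definition oscillator_solution (T alpha : R) (X0 : 'cV[R]_2)
    (W : R -> {RV P >-> R}) (X : R -> Omega -> 'cV[R]_2) : Prop :=
  [/\ forall (t : R) (i : 'I_2), 0 <= t <= T ->
        measurable_fun setT (fun w => X t w i 0),
      {ae P, forall w, forall i : 'I_2,
        {within `[0, T], continuous (fun t : R => X t w i 0)}} &
      {ae P, forall w, forall (t : R) (i : 'I_2), 0 <= t <= T ->
        X t w i 0 = X0 i 0
          + (\int[lebesgue_measure]_(s in `[0, t])
               (oscillator_drift *m X s w) i 0)
          + alpha * col2 0 1 i 0 * increment W 0 t w}].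

Definition beta_matrix (beta h : R) : 'M[R]_2 :=
  (1 + beta * (1 - beta) * h ^+ 2)^-1 *:
    mx2 (1 - (1 - beta) ^+ 2 * h ^+ 2) h
        (- h) (1 - beta ^+ 2 * h ^+ 2).

Definition beta_noise (beta h : R) : 'cV[R]_2 :=
  (1 + beta * (1 - beta) * h ^+ 2)^-1 *: col2 ((1 - beta) * h) 1.

Fixpoint beta_method (alpha beta h : R) (X0 : 'cV[R]_2)
    (W : R -> {RV P >-> R}) (k : nat) (w : Omega) : 'cV[R]_2 :=
  if k is j.+1 then
    beta_matrix beta h *m beta_method alpha beta h X0 W j w
    + (alpha * increment W (j%:R * h) (j.+1%:R * h) w) *: beta_noise beta h
  else X0.

Definition beta_error (T alpha beta : R) (X0 : 'cV[R]_2)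
    (W : R -> {RV P >-> R}) (X : R -> Omega -> 'cV[R]_2) (N : nat)
    (w : Omega) : R :=
  beta_method alpha beta (T / N%:R) X0 W N w 0 0 - X T w 0 0.

(* Convergence in distribution: expectations of bounded continuous functions
   converge. *)
Definition cvg_in_distribution (Y : nat -> Omega -> R)
    (mu : probability (measurableTypeR R) R) : Prop :=
  forall f : R -> R, continuous f -> (exists M : R, forall x, `|f x| <= M) ->
    ('E_P[f \o Y n] @[n --> \oo] --> \int[mu]_x (f x)%:E)%E.

End Processes.

(* Main.v *)
Require Import Defs.
From HB Require Import structures.
From mathcomp Require Import all_boot all_order all_algebra.
From mathcomp Require Import all_classical all_reals all_analysis.
From mathcomp Require Import measurable_realfun.
From mathcomp Require Import ring lra.

(* The noise part of the method is [alpha * \sum_j g_(N-1-j) dW_j], where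
   [g_j = (1 - beta) s_(j+1) + beta s_j] and [s] solves a two-term recurrence
   approximating [sin (j h)] up to O(h^2).  Pathwise, variation of constants and
   Abel summation turn the first component of the exact solution into a limit of
   sums [alpha * \sum_i sin (T - t_i) dW_i] over finer and finer grids.  Hence the
   centred error is an almost sure limit of linear combinations of independent
   Gaussian increments, so it is exactly Gaussian, and its variance is
   [alpha^2 * \sum_j \int_(t_j)^(t_(j+1)) (g_(N-1-j) - sin (T - s))^2 ds].
   On the j-th cell the integrand is [cos^2 (T - t_j) (beta h - (s - t_j))^2] up
   to O(h^3), and [(beta h - u)^2] integrates to [(3 beta^2 - 3 beta + 1) h^3 / 3]
   over [0 <= u <= h]; summing over j gives the expansion, and convergence of the
   standard deviations gives the limit law. *)

Set Implicit Arguments.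
Unset Strict Implicit.
Unset Printing Implicit Defensive.

Import Order.TTheory GRing.Theory Num.Theory.
Import numFieldNormedType.Exports.

Local Open Scope classical_set_scope.
Local Open Scope ring_scope.

(** * Probability laws on the real line *)

(** No stochastic integral is formed. The noise coefficient is constant, so the equation is an
    ordinary integral equation along each path, and probability enters only through the joint law of
    grid increments. Method and solution are compared on a common grid of [N * m.+1] cells, where
    their difference becomes one linear form in independent increments; [m] tends to infinity at
    fixed [N].

    Equality of laws is tested on continuous functions with values in [0, 1], because such tests
    pass to almost sure limits. Centred Gaussian laws are carried as images of one standard normal
    under [x |-> s * x]: a zero deviation is then harmless, and convergence of laws reduces to
    convergence of the factors [s]. Stability under sums comes from the densities, by completing the
    square.

    The constant [T / 6 + sin (2 * T) / 12] is one third of the integral of [cos (T - s) ^+ 2] over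
    [0, T]. *)

Lemma cvg_minr (R : realType) (T : Type) (F : set_system T) (FF : Filter F)
    (f g : T -> R) (a b : R) :
  f @ F --> a -> g @ F --> b -> Num.min (f x) (g x) @[x --> F] --> Num.min a b.
Proof.
move=> fa gb; rewrite minr_absE.
under eq_fun do rewrite minr_absE.
by apply: cvgMl; apply: cvgB; [exact: cvgD|apply: cvg_norm; exact: cvgB].
Qed.

Lemma cvg_maxr (R : realType) (T : Type) (F : set_system T) (FF : Filter F)
    (f g : T -> R) (a b : R) :
  f @ F --> a -> g @ F --> b -> Num.max (f x) (g x) @[x --> F] --> Num.max a b.
Proof.
move=> fa gb; rewrite maxr_absE.
under eq_fun do rewrite maxr_absE.
by apply: cvgMl; apply: cvgD; [exact: cvgD|apply: cvg_norm; exact: cvgB].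
Qed.

(** The ramps [min 1 (n * max 0 (y - x))] are admissible tests and tend pointwise to the indicator
    of the open ray above [x]. Dominated convergence gives equality on open rays, which are stable
    under intersection and generate the Borel sets. *)
Lemma probability_ext_continuous (R : realType)
    (m1 m2 : probability (measurableTypeR R) R) :
  (forall f : R -> R, continuous f -> (forall x, 0 <= f x <= 1) ->
    (\int[m1]_x (f x)%:E = \int[m2]_x (f x)%:E)%E) ->
  forall A : set R, measurable A -> m1 A = m2 A.
Proof.
move=> m12.
have ray (x : R) : m1 `]x, +oo[%classic = m2 `]x, +oo[%classic.
  pose f (n : nat) (y : R) : R := Num.min 1 (n%:R * Num.max 0 (y - x)).
  have cf n : continuous (f n).
    move=> y; apply: cvg_minr; first exact: cvg_cst.
    apply: cvgM; first exact: cvg_cst.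
    apply: cvg_maxr; first exact: cvg_cst.
    by apply: cvgB; [exact: cvg_id|exact: cvg_cst].
  have f01 n y : 0 <= f n y <= 1.
    rewrite /f le_min ler01 ge_min lexx /= andbT.
    by rewrite mulr_ge0 // le_max lexx.
  have fcvg y : (f n y)%:E @[n --> \oo] --> (\1_(`]x, +oo[%classic) y : R)%:E.
    apply/cvg_EFin; first exact: nearW.
    rewrite indicE; have [xy|yx] := ltP x y.
      rewrite mem_set /= ?in_itv /= ?xy //.
      apply: cvg_near_cst; near=> n; rewrite /f /=.
      rewrite (max_idPr _) ?subr_ge0 ?ltW //; apply/min_idPl.
      rewrite -ler_pdivrMr ?subr_gt0 //; near: n; exact: nbhs_infty_ger.
    rewrite memNset /= ?in_itv /= ?andbT; last by apply/negP; rewrite -leNgt.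
    apply: cvg_near_cst; near=> n; rewrite /f /=.
    by rewrite (max_idPl _) ?subr_le0 // mulr0; apply/min_idPr.
  have intf (m : probability (measurableTypeR R) R) :
      (\int[m]_y (f n y)%:E)%E @[n --> \oo] --> m `]x, +oo[%classic.
    have [] := @dominated_convergence _ _ _ m setT measurableT
      (fun n y => (f n y)%:E) (fun y => (\1_(`]x, +oo[%classic) y : R)%:E) (cst 1%E).
    - move=> n; apply/measurable_EFinP; exact: continuous_measurable_fun.
    - by apply/measurable_EFinP; exact: measurable_indic.
    - by apply: aeW => y _; exact: fcvg.
    - by apply: finite_measure_integrable_cst.
    - apply: aeW => y n _ /=; rewrite lee_fin ger0_norm; by case/andP: (f01 n y).
    - move=> _ _; rewrite integral_indic // setIT; exact.
  apply: (cvg_unique _ (intf m1)) => //=.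
  by under eq_fun do rewrite m12 //; exact: intf.
apply: (@measure_unique _ R (measurableTypeR R) (@RGenOInfty.G R)
  (fun n : nat => `](- (n%:R : R)), +oo[%classic)).  
- exact: RGenOInfty.measurableE.
- move=> _ _ [x ->] [y ->]; exists (Num.max x y).
  apply/seteqP; split => z /=; rewrite !in_itv /= !andbT gt_max; first by case=> -> ->.
  by case/andP.
- by move=> n; eexists.
- rewrite -subTset => x _; exists (Num.truncn (- x)).+1 => //=.
  by rewrite in_itv /= andbT ltrNl truncnS_gt.
- by move=> _ [x ->]; exact: ray.
- by move=> k; apply: le_lt_trans (probability_le1 _ _) (ltry _).
Unshelve. all: by end_near. Qed.

(** The Radon-Nikodym derivative and [normal_pdf] have the same integral over every measurable set,
    so they agree almost everywhere and may be exchanged under the integral. *)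
Lemma ge0_integral_normal_prob (R : realType) (m s : R) (f : R -> \bar R) :
  measurable_fun setT f -> (forall x, 0 <= f x)%E ->
  (\int[normal_prob m s]_x f x =
   \int[lebesgue_measure]_x (f x * (normal_pdf m s x)%:E))%E.
Proof.
move=> mf f0.
have dom := @normal_prob_dominates R m s.
rewrite -(Radon_Nikodym_SigmaFinite.change_of_variables dom) //.
have mpdf : measurable_fun setT (fun x => (normal_pdf m s x)%:E).
  by apply/measurable_EFinP; exact: measurable_normal_pdf.
have irn := Radon_Nikodym_SigmaFinite.f_integrable dom.
have mrn := measurable_int _ irn.
apply: ae_eq_integral => //; [exact: emeasurable_funM..|].
apply: ae_eqe_mul2l; apply: integral_ae_eq => //.
move=> E _ mE; rewrite -(Radon_Nikodym_SigmaFinite.f_integral dom) //.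
Qed.

Lemma law_ext_continuous (R : realType) (d1 d2 : measure_display)
    (T1 : measurableType d1) (T2 : measurableType d2)
    (P1 : probability T1 R) (P2 : probability T2 R) (X1 : T1 -> R) (X2 : T2 -> R) :
  measurable_fun setT X1 -> measurable_fun setT X2 ->
  (forall f : R -> R, continuous f -> (forall x, 0 <= f x <= 1) ->
    (\int[P1]_x (f (X1 x))%:E = \int[P2]_x (f (X2 x))%:E)%E) ->
  forall A : set R, measurable A -> P1 (X1 @^-1` A) = P2 (X2 @^-1` A).
Proof.
move=> mX1 mX2 eqX A mA.
have mY1 : measurable_fun [set: T1] (X1 : T1 -> measurableTypeR R) := mX1.
have mY2 : measurable_fun [set: T2] (X2 : T2 -> measurableTypeR R) := mX2.
pose Y1 : {mfun T1 >-> measurableTypeR R} :=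
  HB.pack (X1 : T1 -> measurableTypeR R) (isMeasurableFun.Build _ _ _ _ _ mY1).
pose Y2 : {mfun T2 >-> measurableTypeR R} :=
  HB.pack (X2 : T2 -> measurableTypeR R) (isMeasurableFun.Build _ _ _ _ _ mY2).
apply: (@probability_ext_continuous R (distribution P1 Y1) (distribution P2 Y2)) => //.
move=> f cf f01.
have mf : measurable_fun [set: measurableTypeR R] (EFin \o f).
  by apply/measurable_EFinP; exact: continuous_measurable_fun.
have f0 x : (0 <= (EFin \o f) x)%E by rewrite lee_fin; case/andP: (f01 x).
transitivity (\int[P1]_x ((EFin \o f) \o Y1) x)%E.
  exact: (ge0_integral_distribution Y1 mf).
rewrite /= eqX //.
symmetry; exact: (ge0_integral_distribution Y2 mf).
Qed.

Lemma normal_pdf_affine (R : realType) (m s x : R) : 0 < s ->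
  normal_pdf m s (m + s * x) * s = normal_pdf 0 1 x.
Proof.
move=> s0; have sN0 : s != 0 by rewrite gt_eqF.
rewrite !normal_pdfE ?oner_neq0 // /normal_peak /normal_fun.
rewrite expr1n mul1r subr0 addrC addKr.
rewrite -mulrnAr sqrtrM ?sqr_ge0 // sqrtr_sqr gtr0_norm // invfM.
rewrite -(mulrA s^-1) mulrC mulVKf //.
congr (_ * expR _); field; exact: sN0.
Qed.

Lemma ge0_integral_normal_prob_affine (R : realType) (m s : R) (f : R -> R) :
  0 < s -> continuous f -> (forall x, 0 <= f x) ->
  (\int[normal_prob m s]_x (f x)%:E =
   \int[normal_prob 0 1]_x (f (m + s * x))%:E)%E.
Proof.
move=> s0 cf f0.
have dF x : is_derive x (1:R) (fun x : R => m + s * x) s.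
  by apply: is_derive_eq; rewrite /GRing.scale /=; ring.
have dE : (fun x : R => m + s * x)^`()%classic = cst s.
  by apply/funext => x; rewrite derive1E derive_val.
have cfa : continuous (fun x => f (m + s * x)).
  move=> x; apply: (@continuous_comp _ _ _ (fun x => m + s * x) f); last exact: cf.
  by apply: cvgD; [exact: cvg_cst|apply: cvgM; [exact: cvg_cst|exact: cvg_id]].
rewrite !ge0_integral_normal_prob; last first.
- by move=> x; rewrite lee_fin.
- by apply/measurable_EFinP; exact: continuous_measurable_fun.
- by move=> x; rewrite lee_fin.
- by apply/measurable_EFinP; exact: continuous_measurable_fun.
under eq_integral do rewrite -EFinM.
rewrite (@increasing_ge0_integration_by_substitutionT R (fun x => m + s * x)
  (fun x => f x * normal_pdf m s x)).
- rewrite dE; apply: eq_integral => x _ /=.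
  by rewrite -EFinM -(@normal_pdf_affine _ m s) // mulrA.
- by move=> x y xy; rewrite ltrD2l ltr_pM2l.
- by rewrite dE => ?; exact: cvg_cst.
- by rewrite dE; exact: is_cvg_cst.
- by rewrite dE; exact: is_cvg_cst.
- by move=> x; exact: ex_derive.
- under eq_fun do rewrite addrC mulrC.
  apply/cvgrNyPle => A; near=> x.
  rewrite -lerBrDr -ler_pdivlMr //; near: x; exact: nbhs_ninfty_le.
- under eq_fun do rewrite addrC mulrC.
  apply/cvgryPge => A; near=> x.
  rewrite -lerBlDr -ler_pdivrMr //; near: x; exact: nbhs_pinfty_ge.
- by move=> x; apply: cvgM; [exact: cf|apply: continuous_normal_pdf; rewrite gt_eqF].
- by move=> x; rewrite mulr_ge0 // normal_pdf_ge0.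
Unshelve. all: by end_near. Qed.

(** The substitution above requires an increasing map; this reflection supplies the negative
    scalings. *)
Lemma ge0_integral_normal_prob_opp (R : realType) (f : R -> R) :
  continuous f -> (forall x, 0 <= f x) ->
  (\int[normal_prob 0 1]_x (f (- x))%:E = \int[normal_prob 0 1]_x (f x)%:E)%E.
Proof.
move=> cf f0.
have cfN : continuous (fun x => f (- x)).
  move=> x; apply: (@continuous_comp _ _ _ (@GRing.opp R) f); last exact: cf.
  by apply: cvgN; exact: cvg_id.
rewrite !ge0_integral_normal_prob; last first.
- by move=> x; rewrite lee_fin.
- by apply/measurable_EFinP; exact: continuous_measurable_fun.
- by move=> x; rewrite lee_fin.
- by apply/measurable_EFinP; exact: continuous_measurable_fun.
pose g x := ((f x)%:E * (normal_pdf 0 1 x)%:E)%E.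
have mg : measurable_fun [set: measurableTypeR R] g.
  apply: emeasurable_funM; apply/measurable_EFinP.
    exact: continuous_measurable_fun.
  exact: measurable_normal_pdf.
have g0 x : (0 <= g x)%E by rewrite mule_ge0 // lee_fin ?normal_pdf_ge0.
transitivity (\int[lebesgue_measure]_x (g \o -%R) x)%E.
  apply: eq_integral => x _; rewrite /g /=; congr (_ * _%:E)%E.
  by rewrite !normal_pdfE ?oner_neq0 // /normal_fun !subr0 sqrrN.
have mN : measurable_fun [set: measurableTypeR R] (-%R : measurableTypeR R -> measurableTypeR R).
  exact: (@oppr_measurable R setT).
rewrite -[LHS](@ge0_integral_pushforward _ _ _ _ R (-%R : measurableTypeR R -> measurableTypeR R) mN
  lebesgue_measure setT g) //.
by apply: eq_measure_integral => A mA _; exact: lebesgue_measureN.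
Qed.

Lemma normal_peakE (R : realType) (s : R) : 0 < s -> normal_peak s = normal_peak 1 / s.
Proof.
move=> s0; rewrite /normal_peak expr1n mul1r -mulrnAr sqrtrM ?sqr_ge0 //.
by rewrite sqrtr_sqr gtr0_norm // invfM mulrC.
Qed.

(* Bayes' rule for a Gaussian prior and a Gaussian likelihood, by completing
   the square. *)
Lemma normal_pdf_bayes (R : realType) (s t x z : R) : 0 < t ->
  let r := Num.sqrt (s ^+ 2 + t ^+ 2) in
  normal_pdf (s * x) t z * normal_pdf 0 1 x =
  normal_pdf 0 r z * normal_pdf (z * s / r ^+ 2) (t / r) x.
Proof.
move=> t0 r; have tN0 : t != 0 by rewrite gt_eqF.
have q0 : 0 < s ^+ 2 + t ^+ 2 by rewrite ltr_wpDl ?sqr_ge0 // exprn_gt0.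
have r0 : 0 < r by rewrite sqrtr_gt0.
have rN0 : r != 0 by rewrite gt_eqF.
have rE : r ^+ 2 = s ^+ 2 + t ^+ 2 by rewrite sqr_sqrtr // ltW.
rewrite !normal_pdfE ?oner_neq0 ?mulf_neq0 ?invr_eq0 // /normal_fun.
rewrite mulrACA [RHS]mulrACA -!expRD; congr (_ * expR _).
  rewrite (normal_peakE t0) (normal_peakE r0) (normal_peakE (divr_gt0 t0 r0)).
  by field; rewrite tN0 rN0.
rewrite expr_div_n rE; field.
by rewrite tN0 gt_eqF.
Qed.

(** * Convolution of two centred Gaussian laws *)

Section convolution.
Context (R : realType).
Local Notation N01 := (normal_prob (0:R) 1).
Local Notation mu := (@lebesgue_measure R).
Local Notation T := (measurableTypeR R).

Lemma measurable_lincomb (s t : R) :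
  measurable_fun [set: T * T] (fun xy : T * T => s * xy.1 + t * xy.2 : T).
Proof.
by apply: measurable_funD; apply: measurable_funM.
Qed.

(** Substituting [z = s * x + t * y] in the inner integral and exchanging the integrals leaves [f z]
    times the joint density of [(x, z)]. Factoring that density the other way round, as the marginal
    of [z] times the conditional density of [x], lets [x] be integrated out. *)
Lemma integral_normal_conv_pos (s t : R) (f : R -> R) :
  0 < t -> continuous f -> (forall x, 0 <= f x) ->
  (\int[N01]_x \int[N01]_y (f (s * x + t * y))%:E =
   \int[N01]_z (f (Num.sqrt (s ^+ 2 + t ^+ 2) * z))%:E)%E.
Proof.
move=> t0 cf f0; set r := Num.sqrt _.
have q0 : 0 < s ^+ 2 + t ^+ 2 by rewrite ltr_wpDl ?sqr_ge0 // exprn_gt0.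
have r0 : 0 < r by rewrite sqrtr_gt0.
have mf : measurable_fun [set: T] f by exact: continuous_measurable_fun.
have mF : measurable_fun [set: T] (fun x : T => \int[N01]_y (f (s * x + t * y))%:E)%E.
  apply: (@measurable_fun_fubini_tonelli_F _ _ T T R N01
    (fun xy => (f (s * xy.1 + t * xy.2))%:E)).
    apply/measurable_EFinP.
    by apply: (measurableT_comp mf); exact: measurable_lincomb.
  by move=> x; rewrite lee_fin.
rewrite ge0_integral_normal_prob //; last first.
  by move=> x; apply: integral_ge0 => y _; rewrite lee_fin.
pose k (xz : T * T) : R := f xz.2 * normal_pdf (s * xz.1) t xz.2 * normal_pdf 0 1 xz.1.
have k0 xz : (0 <= (k xz)%:E)%E by rewrite lee_fin !mulr_ge0 ?normal_pdf_ge0.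
have mk : measurable_fun [set: T * T] (EFin \o k).
  apply/measurable_EFinP; apply: measurable_funM; last first.
    by apply: measurableT_comp => //; exact: measurable_normal_pdf.
  apply: measurable_funM; first exact: measurableT_comp.
  (* Joint measurability: the density depends on the pair only through the linear form
     [z - s * x]. *)
  rewrite (_ : (fun x => _) = normal_pdf 0 t \o (fun xz : T * T => - s * xz.1 + 1 * xz.2)).
    apply: measurableT_comp; first exact: measurable_normal_pdf.
    exact: measurable_lincomb.
  apply/funext => xz /=; rewrite !normal_pdfE ?gt_eqF // /normal_fun.
  by rewrite subr0 mul1r (mulNr s) (addrC (- (s * _))).
transitivity (\int[mu]_x \int[mu]_z (k (x, z))%:E)%E.
  apply: eq_integral => x _.
  rewrite -(@ge0_integral_normal_prob_affine R (s * x) t f) //.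
  rewrite ge0_integral_normal_prob; last first.
  - by move=> y; rewrite lee_fin.
  - exact/measurable_EFinP.
  rewrite -ge0_integralZr ?lee_fin ?normal_pdf_ge0 //.
  - apply: emeasurable_funM; apply/measurable_EFinP => //.
    exact: measurable_normal_pdf.
  - by move=> y _; rewrite mule_ge0 // lee_fin // normal_pdf_ge0.
rewrite (@fubini_tonelli _ _ T T R mu mu (EFin \o k)) //.
have -> : (\int[N01]_z (f (r * z))%:E)%E = (\int[normal_prob 0 r]_z (f z)%:E)%E.
  rewrite (ge0_integral_normal_prob_affine 0 r0) //.
  by apply: eq_integral => x _; rewrite add0r.
rewrite ge0_integral_normal_prob; last first.
- by move=> y; rewrite lee_fin.
- exact/measurable_EFinP.
apply: eq_integral => z _ /=.
(* By [normal_pdf_bayes], the only factor still containing [x] is a normal density, whose integral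
   is 1. *)
transitivity (\int[mu]_x (((f z)%:E * (normal_pdf 0 r z)%:E) *
   (normal_pdf (z * s / r ^+ 2) (t / r) x)%:E))%E.
  apply: eq_integral => x _.
  by rewrite /k /= -!EFinM -mulrA normal_pdf_bayes // mulrA.
rewrite ge0_integralZl //.
- by rewrite integral_normal_pdf mule1.
- by apply/measurable_EFinP; exact: measurable_normal_pdf.
- by move=> x _; rewrite lee_fin normal_pdf_ge0.
- by rewrite mule_ge0 // lee_fin // normal_pdf_ge0.
Qed.

Lemma ge0_integral_normal_abs (a t : R) (f : R -> R) :
  continuous f -> (forall x, 0 <= f x) ->
  (\int[N01]_y (f (a + t * y))%:E = \int[N01]_y (f (a + `|t| * y))%:E)%E.
Proof.
move=> cf f0; have [t0|t0] := leP 0 t; first by rewrite ger0_norm.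
rewrite ltr0_norm // -[RHS](@ge0_integral_normal_prob_opp R (fun y => f (a + - t * y))) //.
  by apply: eq_integral => y _; rewrite mulrNN.
move=> x; apply: (@continuous_comp _ _ _ (fun x => a + - t * x) f); last exact: cf.
by apply: cvgD; [exact: cvg_cst|apply: cvgM; [exact: cvg_cst|exact: cvg_id]].
Qed.

(** If [t = 0] the inner integrand is constant; otherwise the symmetry of the normal law replaces
    [t] by its absolute value. *)
Lemma integral_normal_conv (s t : R) (f : R -> R) :
  continuous f -> (forall x, 0 <= f x) ->
  (\int[N01]_x \int[N01]_y (f (s * x + t * y))%:E =
   \int[N01]_z (f (Num.sqrt (s ^+ 2 + t ^+ 2) * z))%:E)%E.
Proof.
move=> cf f0; have [->|tN0] := eqVneq t 0.
  rewrite expr0n addr0 sqrtr_sqr.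
  under eq_integral => x _.
    under eq_integral do rewrite mul0r addr0.
    rewrite integral_cst //= [X in (_ * X)%E](@probability_setT _ T R N01) mule1; over.
  transitivity (\int[N01]_y (f (0 + s * y))%:E)%E.
    by apply: eq_integral => y _; rewrite add0r.
  rewrite ge0_integral_normal_abs //.
  by apply: eq_integral => y _; rewrite add0r.
under eq_integral => x _ do rewrite ge0_integral_normal_abs //.
rewrite integral_normal_conv_pos // ?normr_gt0 //.
by rewrite real_normK // num_real.
Qed.

Lemma normal_conv (s t : R) (A : set T) : measurable A ->
  (N01 \x N01)%E ((fun xy => s * xy.1 + t * xy.2) @^-1` A) =
  N01 ((fun z => Num.sqrt (s ^+ 2 + t ^+ 2) * z) @^-1` A).
Proof.
apply: (@law_ext_continuous R _ _ (T * T)%type T (N01 \x N01)%E N01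
  (fun xy => s * xy.1 + t * xy.2) (fun z => Num.sqrt (s ^+ 2 + t ^+ 2) * z)).
- exact: measurable_lincomb.
- exact: measurable_funM.
move=> f cf f01; have f0 x : 0 <= f x by case/andP: (f01 x).
rewrite -integral_normal_conv //.
rewrite (@fubini_tonelli1 _ _ T T R N01 N01 (fun xy => (f (s * xy.1 + t * xy.2))%:E)) //.
- apply/measurable_EFinP; apply: (measurableT_comp _ (measurable_lincomb s t)).
  exact: continuous_measurable_fun.
- by move=> x; rewrite lee_fin.
Qed.

End convolution.

Lemma ge0_integral_law_eq (R : realType) (d1 d2 : measure_display)
    (T1 : measurableType d1) (T2 : measurableType d2)
    (P1 : probability T1 R) (P2 : probability T2 R) (X1 : T1 -> R) (X2 : T2 -> R) :
  measurable_fun setT X1 -> measurable_fun setT X2 ->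
  (forall A : set R, measurable A -> P1 (X1 @^-1` A) = P2 (X2 @^-1` A)) ->
  forall g : R -> \bar R, measurable_fun setT g -> (forall x, 0 <= g x)%E ->
  (\int[P1]_x g (X1 x) = \int[P2]_x g (X2 x))%E.
Proof.
move=> mX1 mX2 eqX g mg g0.
rewrite -[LHS](@ge0_integral_pushforward _ _ T1 R R X1 mX1 P1 setT g) //.
rewrite -[RHS](@ge0_integral_pushforward _ _ T2 R R X2 mX2 P2 setT g) //.
by apply: eq_measure_integral => A mA _; exact: eqX.
Qed.

Lemma integral_law_eq (R : realType) (d1 d2 : measure_display)
    (T1 : measurableType d1) (T2 : measurableType d2)
    (P1 : probability T1 R) (P2 : probability T2 R) (X1 : T1 -> R) (X2 : T2 -> R) :
  measurable_fun setT X1 -> measurable_fun setT X2 ->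
  (forall A : set R, measurable A -> P1 (X1 @^-1` A) = P2 (X2 @^-1` A)) ->
  forall g : R -> \bar R, measurable_fun setT g ->
  (\int[P1]_x g (X1 x) = \int[P2]_x g (X2 x))%E.
Proof.
move=> mX1 mX2 eqX g mg; rewrite integralE [RHS]integralE.
rewrite -[fun x => g (X1 x)]/(g \o X1) -[fun x => g (X2 x)]/(g \o X2).
rewrite [in LHS](funepos_comp g X1) [in RHS](funepos_comp g X2) [in LHS](funeneg_comp g X1) [in RHS](funeneg_comp g X2); congr (_ - _)%E.
  exact: (ge0_integral_law_eq mX1 mX2 eqX (measurable_funepos mg) (fun x => funepos_ge0 g x)).
exact: (ge0_integral_law_eq mX1 mX2 eqX (measurable_funeneg mg) (fun x => funeneg_ge0 g x)).
Qed.

(** * First and second moments of the standard normal law *)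

Section moments.
Context (R : realType).
Local Notation N01 := (normal_prob (0:R) 1).
Local Notation mu := (@lebesgue_measure R).
Local Notation T := (measurableTypeR R).
Local Notation phi := (normal_pdf (0:R) 1).

(** This is the integration by parts behind the second moment: it trades [x ^+ 2 * phi x] for
    [phi x] at the cost of a boundary term. *)
Lemma is_derive_mul_normal_pdf (x : R) :
  is_derive x (1:R) (fun x : R => x * phi x) (phi x - x ^+ 2 * phi x).
Proof.
rewrite normal_pdfE ?oner_neq0 // /normal_fun.
apply: is_derive_eq; rewrite /GRing.scale /=.
by field.
Qed.

Lemma cvg_mul_normal_pdf : (n%:R * phi n%:R) @[n --> \oo] --> (0:R).
Proof.
(* With [expR u >= 1 + u] at [u = n^2 / 2], the upper bound amounts to [n (n + 1) <= 4 + 2 n^2],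
   which explains the factor 4. *)
apply: (@squeeze_cvgr _ _ _ _ (cst 0) (fun n => (4 * normal_peak 1) * n.+1%:R^-1)).
- near=> n; rewrite mulr_ge0 ?normal_pdf_ge0 //=.
  rewrite normal_pdfE ?oner_neq0 // /normal_fun mulrCA -(mulrA 4) (mulrCA 4).
  rewrite ler_wpM2l ?normal_peak_ge0 // ler_pdivlMr //.
  have -> : - (n%:R - 0) ^+ 2 / (1 ^+ 2 *+ 2) = - (n%:R ^+ 2 / 2) :> R.
    by rewrite subr0 expr1n mulNr.
  rewrite expRN mulrAC ler_pdivrMr ?expR_gt0 //.
  apply: (@le_trans _ _ (4 * (1 + n%:R ^+ 2 / 2))); last first.
    by rewrite ler_wpM2l // expR_ge1Dx.
  rewrite -natr1; have := ler0n R n; nra.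
- exact: cvg_cst.
- rewrite -[X in _ --> X](mulr0 (4 * normal_peak 1)).
  by apply: cvgM; [exact: cvg_cst|exact: cvg_harmonic].
Unshelve. all: by end_near. Qed.

Lemma itvNn_homo : {homo (fun n : nat => `[(- n%:R : R), n%:R]%classic) : n m / (n <= m)%N >-> (n <= m)%O}.
Proof.
move=> n m nm; apply/subsetPset; apply: subset_itv; rewrite bnd_simp ?lerN2 ler_nat //.
Qed.

Lemma bigcup_itvNn : \bigcup_n `[(- n%:R : R), n%:R]%classic = setT.
Proof.
rewrite -subTset => x _; exists (Num.truncn `|x|).+1 => //=.
by rewrite in_itv /= -ler_norml ltW // truncnS_gt.
Qed.

Lemma cvg_integral_itvNn (f : R -> R) : measurable_fun setT f -> (forall x, 0 <= f x) ->
  (\int[mu]_(x in `[(- n%:R)%R, n%:R]) (f x)%:E)%E @[n --> \oo] --> (\int[mu]_x (f x)%:E)%E.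
Proof.
move=> mf f0; rewrite -bigcup_itvNn.
apply: ge0_nondecreasing_set_cvg_integral => //.
- exact: itvNn_homo.
- by move=> n; apply: measurable_funTS; exact/measurable_EFinP.
- by move=> n x _; rewrite lee_fin.
Qed.

(** On [[-n, n]] the integral of [x ^+ 2 * phi x] is that of [phi] minus the boundary term
    [2 * (n * phi n)]; the former tends to 1 and the latter to 0. *)
Lemma integral_normal_sqr : (\int[N01]_x (x ^+ 2)%:E = 1)%E.
Proof.
have cphi : continuous phi by apply: continuous_normal_pdf; rewrite oner_neq0.
have cg : continuous (fun x : R => x ^+ 2 * phi x).
  by move=> x; apply: cvgM; [exact: sqr_continuous|exact: cphi].
rewrite ge0_integral_normal_prob; last first.
- by move=> x; rewrite lee_fin sqr_ge0.
- by apply/measurable_EFinP; exact: measurable_funX.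
under eq_integral do rewrite -EFinM.
have h1 := @cvg_integral_itvNn (fun x => x ^+ 2 * phi x) (continuous_measurable_fun cg)
  (fun x => mulr_ge0 (sqr_ge0 x) (normal_pdf_ge0 0 1 x)).
have h2 := @cvg_integral_itvNn phi (continuous_measurable_fun cphi)
  (fun x => normal_pdf_ge0 0 1 x).
rewrite integral_normal_pdf in h2.
apply: (cvg_unique _ h1) => //.
have -> : (1 : \bar R)%E = (1 - (2 * 0)%R%:E)%E by rewrite mulr0 sube0.
have h3 : ((2 * (n%:R * phi n%:R))%:E : \bar R) @[n --> \oo] --> (2 * 0 : R)%:E.
  apply: cvg_EFin; first exact: nearW.
  by apply: cvgM; [exact: cvg_cst|exact: cvg_mul_normal_pdf].
rewrite /=; apply: (cvg_trans _ (cvgeB _ h2 h3)) => //.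
apply: near_eq_cvg; near=> n => /=.
have n0 : (0 : R) < n%:R by rewrite ltr0n; near: n; exact: nbhs_infty_gt.
have nn : - n%:R < n%:R :> R by rewrite (lt_trans _ n0) // oppr_lt0.
have intc f : continuous f -> mu.-integrable `[- n%:R, n%:R] (EFin \o f).
  move=> cf; apply: continuous_compact_integrable; first exact: segment_compact.
  exact: continuous_subspaceT.
have cxphi : continuous (fun x : R => x * phi x).
  by move=> x; apply: cvgM; [exact: cvg_id|exact: cphi].
have cd : continuous (fun x : R => phi x - x ^+ 2 * phi x).
  by move=> x; apply: cvgB; [exact: cphi|exact: cg].
have FTC : (\int[mu]_(x in `[(- n%:R)%R, n%:R]) (phi x - x ^+ 2 * phi x)%:E =
    (2 * (n%:R * phi n%:R))%:E)%E.
  rewrite (@continuous_FTC2 R (fun x => phi x - x ^+ 2 * phi x) (fun x => x * phi x) _ _ nn).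
  - rewrite (_ : phi (- n%:R) = phi n%:R); last first.
      by rewrite !normal_pdfE ?oner_neq0 // /normal_fun !subr0 sqrrN.
    by rewrite -EFinB; congr EFin; ring.
  - exact: continuous_subspaceT.
  - split.
    + by move=> x _; case: (is_derive_mul_normal_pdf x).
    + by apply: cvg_at_right_filter; exact: cxphi.
    + by apply: cvg_at_left_filter; exact: cxphi.
  - by move=> x _; case: (is_derive_mul_normal_pdf x) => _; rewrite derive1E.
rewrite EFinN -FTC -integralB_EFin //; [|exact: intc|exact: intc].
by apply: eq_integral => x _; congr EFin; rewrite /=; ring.
Unshelve. all: by end_near. Qed.

Lemma integrable_normal_id : N01.-integrable setT (EFin : T -> \bar R).
Proof.
apply: (@le_integrable _ T R N01 setT measurableT _ (fun x : T => (1 + x ^+ 2)%:E)).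
- by apply/measurable_EFinP.
- move=> x _ /=; rewrite lee_fin [leRHS]ger0_norm ?addr_ge0 ?sqr_ge0 //.
  have [x0|x0] := leP 0 x; [rewrite ger0_norm //|rewrite ltr0_norm //]; nra.
- under eq_fun do rewrite EFinD.
  apply: integrableD => //; first exact: finite_measure_integrable_cst.
  apply/integrableP; split.
    by apply/measurable_EFinP; exact: measurable_funX.
  under eq_integral => x _ do rewrite /= ger0_norm ?sqr_ge0 //.
  by rewrite integral_normal_sqr ltry.
Qed.

(** The positive and negative parts are exchanged by reflection; integrability makes their common
    integral finite, so that it can be subtracted. *)
Lemma integral_normal_id : (\int[N01]_x x%:E = 0)%E.
Proof.
have i1 := integrable_normal_id.
rewrite integralE.
have e x : ((EFin : T -> \bar R)^\+ x = (Num.max x 0)%:E)%E.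
  by rewrite funeposE -EFin_max.
have e' x : ((EFin : T -> \bar R)^\- x = (Num.max (- x) 0)%:E)%E.
  by rewrite funenegE -EFinN -EFin_max.
under eq_integral do rewrite e.
under [X in (_ - X)%E]eq_integral do rewrite e'.
rewrite (@ge0_integral_normal_prob_opp R (fun x => Num.max x 0)).
- rewrite subee //.
  have := integrable_fin_num _ (integrable_funepos measurableT i1).
  by under eq_integral do rewrite e; exact.
- by move=> x; apply: cvg_maxr; [exact: cvg_id|exact: cvg_cst].
- by move=> x; rewrite le_max lexx orbT.
Qed.

End moments.

(** * Sums of independent Gaussian variables *)

(** Rectangles are stable under intersection and generate the product sigma-algebra. This turns a
    product formula for events into an identity of joint laws. *)
Lemma measure_prod_ext (R : realType) (d1 d2 : measure_display)
    (T1 : measurableType d1) (T2 : measurableType d2)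
    (m1 m2 : {measure set (T1 * T2) -> \bar R}) :
  (forall A B, measurable A -> measurable B -> m1 (A `*` B) = m2 (A `*` B)) ->
  (m1 setT < +oo)%E ->
  forall X : set (T1 * T2), measurable X -> m1 X = m2 X.
Proof.
move=> m12 m1oo; pose C : set (set (T1 * T2)) :=
  [set C | exists A, measurable A /\ exists B, measurable B /\ C = A `*` B].
apply: (measure_unique C (fun=> setT)) => //.
- rewrite measurable_prod_measurableType //; congr (<<s _ >>).
  rewrite predeqE => Z; split => [[A mA [B mB <-]]|[A [mA [B [mB ->]]]]].
    by exists A; split => //; exists B.
  by exists A => //; exists B.
- move=> /= _ _ [X1 [mX1 [X2 [mX2 ->]]]] [Y1 [mY1 [Y2 [mY2 ->]]]].
  rewrite -setXI; exists (X1 `&` Y1); split; first exact: measurableI.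
  by exists (X2 `&` Y2); split => //; exact: measurableI.
- by move=> _; exists setT; split => //; exists setT; split => //; rewrite setXTT.
- by rewrite bigcup_const.
- by move=> _ [A [mA [B [mB ->]]]]; exact: m12.
Qed.

(* Unlike [normal_prob 0 s], this is the Dirac mass at 0 when [s = 0]. *)
Definition scaled_normal (R : realType) (s : R) (A : set R) : \bar R :=
  normal_prob 0 1 ((fun x => s * x) @^-1` A).

(** The event [E] stands for the variables not yet summed; carrying it along is what makes the
    induction below possible. Restricted to [E], the joint law of [(X, Y)] agrees on rectangles with
    [P E] times the law of two independent scaled normals, hence agrees everywhere, and
    [normal_conv] handles the half-plane-like set defined by [X + c * Y]. *)
Lemma normal_merge (R : realType) (d : measure_display) (T : measurableType d)
    (P : probability T R) (X Y : T -> R) (E : set T) (a b c : R) :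
  measurable_fun setT X -> measurable_fun setT Y -> measurable E ->
  (forall A B : set R, measurable A -> measurable B ->
    P (X @^-1` A `&` (Y @^-1` B `&` E)) =
    (scaled_normal a A * (scaled_normal b B * P E))%E) ->
  forall A : set R, measurable A ->
    P ((fun w => X w + c * Y w) @^-1` A `&` E) =
    (scaled_normal (Num.sqrt (a ^+ 2 + (c * b) ^+ 2)) A * P E)%E.
Proof.
move=> mX mY mE XYE A mA.
pose V := measurableTypeR R.
pose N := normal_prob (0:R) 1.
have mXY : measurable_fun [set: T] (fun w => (X w, Y w) : V * V).
  by apply: measurable_fun_pair.
have mab : measurable_fun [set: V * V] (fun xy : V * V => (a * xy.1, b * xy.2) : V * V).
  by apply: measurable_fun_pair; apply: measurable_funM.
have mscal (k : R) : measurable_fun [set: V] (fun x : V => k * x : V).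
  exact: measurable_funM.
have PE0 : 0 <= fine (P E) by rewrite fine_ge0.
have PEf : P E \is a fin_num by rewrite fin_num_measure.
pose p : {nonneg R} := NngNum PE0.
pose m1f : {measure set (V * V) -> \bar R} :=
  pushforward (mrestr P mE) (fun w => (X w, Y w) : V * V).
pose m2f : {measure set (V * V) -> \bar R} :=
  mscale p (pushforward (N \x N)%E (fun xy : V * V => (a * xy.1, b * xy.2) : V * V)).
pose m1 := m1f mXY; pose m2 := m2f mab.
have m12 : forall Z : set (V * V), measurable Z -> m1 Z = m2 Z.
  apply: measure_prod_ext.
    move=> A1 B1 mA1 mB1.
    transitivity (P (X @^-1` A1 `&` (Y @^-1` B1 `&` E))).
      by rewrite setIA.
    rewrite XYE // /m2 /m2f /= /mscale /= /pushforward fineK //.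
    have -> : (fun xy : V * V => (a * xy.1, b * xy.2) : V * V) @^-1` (A1 `*` B1) =
      ((fun x => a * x) @^-1` A1) `*` ((fun x => b * x) @^-1` B1) by [].
    rewrite [X in _ = (_ * X)%E](@product_measure1E _ _ V V R N N) //.
    + by rewrite muleA muleC.
    + by rewrite -[X in measurable X]setTI; exact: (mscal a).
    + by rewrite -[X in measurable X]setTI; exact: (mscal b).
  rewrite /m1 /m1f /= /pushforward preimage_setT /mrestr setTI.
  by apply: le_lt_trans (probability_le1 _ _) (ltry _).
have mZ : measurable [set xy : V * V | A (xy.1 + c * xy.2)].
  have := @measurable_lincomb R 1 c measurableT A mA; rewrite setTI.
  by congr (measurable _); apply/seteqP; split => xy /=; rewrite mul1r.
have := m12 _ mZ; rewrite /m1 /m1f /m2 /m2f /= /mscale /pushforward /mrestr /= => ->.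
rewrite fineK // muleC; congr (_ * _)%E.
rewrite /scaled_normal -normal_conv //; congr ((N \x N)%E _).
by apply/seteqP; split => xy /=; rewrite mulrA.
Qed.

Lemma scaled_normal0 (R : realType) (A : set R) : scaled_normal 0 A = (\1_A (0 : R))%:E.
Proof.
rewrite /scaled_normal indicE.
have [A0|A0] := boolP ((0 : R) \in A).
  rewrite (_ : _ @^-1` A = setT) ?probability_setT //.
  by rewrite -subTset => x _ /=; rewrite mul0r; exact: set_mem.
rewrite (_ : _ @^-1` A = set0) ?measure0 //.
by rewrite -subset0 => x /=; rewrite mul0r => /mem_set; rewrite (negPf A0).
Qed.

(** Induction on the number [k] of summed terms. The invariant factors the law of the partial sum
    against an arbitrary event [tail B k] in the remaining variables, so independence of a partial
    sum from the next term never has to be derived separately. *)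
Lemma normal_indep_sum (R : realType) (d : measure_display) (T : measurableType d)
    (P : probability T R) (n : nat) (D : nat -> T -> R) (c s : nat -> R) :
  (forall i, measurable_fun setT (D i)) ->
  (forall i, (i < n)%N -> forall A : set R, measurable A ->
    P (D i @^-1` A) = scaled_normal (s i) A) ->
  (forall B : nat -> set R, (forall i, measurable (B i)) ->
    P (\bigcap_(i in `I_n) (D i @^-1` B i)) = (\prod_(i < n) P (D i @^-1` B i))%E) ->
  forall A : set R, measurable A ->
    P ((fun w => \sum_(i < n) c i * D i w) @^-1` A) =
    scaled_normal (Num.sqrt (\sum_(i < n) (c i * s i) ^+ 2)) A.
Proof.
move=> mD Ds Dind.
pose tail (B : nat -> set R) k : set T :=
  \bigcap_(i in [set i | (k <= i < n)%N]) (D i @^-1` B i).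
have mDB i (B : set R) : measurable B -> measurable (D i @^-1` B).
  by move=> mB; rewrite -[X in measurable X]setTI; exact: mD.
have mtail B k : (forall i, measurable (B i)) -> measurable (tail B k).
  move=> mB; apply: bigcap_measurableType.
  by move=> i _; exact: mDB.
have mS k : measurable_fun setT (fun w => \sum_(i < k) c i * D i w).
  by apply: measurable_sum => i; apply: measurable_funM.
have Ptail (B : nat -> set R) k : (forall i, measurable (B i)) ->
    P (tail B k) = (\prod_(k <= i < n) P (D i @^-1` B i))%E.
  (* Padding with [setT] below [k] makes the product rule for all [n] variables apply to the
     tail. *)
  move=> mB; pose B' i := if (k <= i)%N then B i else setT.
  have mB' i : measurable (B' i) by rewrite /B'; case: ifP.
  rewrite (_ : tail B k = \bigcap_(i in `I_n) (D i @^-1` B' i)); last first.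
    apply/seteqP; split => w /= H i /=.
      move=> iltn; rewrite /B'; case: ifP => // ki; apply: H => /=; rewrite ki //.
    by move=> /andP[ki iltn]; have := H i iltn; rewrite /B' ki.
  rewrite Dind // -(big_mkord xpredT (fun i => P (D i @^-1` B' i))).
  have [kn|nk] := leqP k n.
    rewrite (big_cat_nat (leq0n k) kn) /= big_nat_cond big1 ?mul1e; last first.
      by move=> i; rewrite andbT /B' => /andP[_]; rewrite ltnNge => /negPf ->; rewrite preimage_setT probability_setT.
    by apply: eq_big_nat => i /andP[ki _]; rewrite /B' ki.
  rewrite [RHS]big_geq 1?ltnW // big_nat_cond big1 // => i.
  rewrite andbT /B' => /andP[_ iltn]; rewrite leqNgt (ltn_trans iltn nk) /=.
  by rewrite preimage_setT probability_setT.
have main k : (k <= n)%N -> forall (B : nat -> set R) (A : set R),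
    (forall i, measurable (B i)) -> measurable A ->
    P ((fun w => \sum_(i < k) c i * D i w) @^-1` A `&` tail B k) =
    (scaled_normal (Num.sqrt (\sum_(i < k) (c i * s i) ^+ 2)) A * P (tail B k))%E.
  elim: k => [_ B A mB mA|k IH kn B A mB mA].
    rewrite big_ord0 sqrtr0 scaled_normal0 indicE.
    under eq_fun do rewrite big_ord0.
    have [A0|A0] := boolP (0 \in A).
      by rewrite mul1e; congr (P _); rewrite setIidr // => w _; exact: set_mem.
    rewrite mul0e; apply/eqP; rewrite -(measure0 P); apply/eqP; congr (P _).
    by rewrite -subset0 => w [/= Aw _]; move: A0; rewrite (mem_set Aw).
  have s0 : 0 <= \sum_(i < k) (c i * s i) ^+ 2 by apply: sumr_ge0 => i _; exact: sqr_ge0.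
  rewrite big_ord_recr /= -{1}(sqr_sqrtr s0).
  rewrite -(normal_merge (X := fun w => \sum_(i < k) c i * D i w) (Y := D k)) //.
  - by under eq_fun do rewrite big_ord_recr /=.
  - exact: mtail.
  (* An event on [D k] together with the tail from [k.+1] is a tail from [k], so the induction
     hypothesis at [B'] yields the threefold factorization that [normal_merge] asks for. *)
  - move=> A1 B1 mA1 mB1; pose B' i := if i == k then B1 else B i.
    have mB' i : measurable (B' i) by rewrite /B'; case: ifP.
    have tE : D k @^-1` B1 `&` tail B k.+1 = tail B' k.
      apply/seteqP; split => w.
        move=> [wk wt] i /= /andP[]; rewrite leq_eqVlt /B' => /predU1P[<- _|ki iltn].
          by rewrite eqxx.
        by rewrite gtn_eqF //; apply: wt => /=; rewrite ki.
      move=> H; split; first by have := H k; rewrite /= /B' eqxx leqnn; exact.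
      move=> i /= /andP[ki iltn]; have := H i; rewrite /= /B' gtn_eqF // (ltnW ki).
      exact.
    have Bk : B' k = B1 by rewrite /B' eqxx.
    rewrite tE IH 1?ltnW // !Ptail // big_ltn //= Bk Ds //.
    congr (_ * (_ * _))%E; apply: eq_big_nat => i /andP[ki _].
    by rewrite /B' gtn_eqF.
move=> A mA; have := main n (leqnn n) (fun=> setT) A (fun=> measurableT) mA.
rewrite Ptail // big_geq // mule1 => <-; congr (P _).
rewrite setIidl // => w _ i /=; by rewrite andbC ltnNge andNb.
Qed.

Lemma bounded_cvg_integral (R : realType) (d : measure_display) (T : measurableType d)
    (P : probability T R) (g_ : nat -> T -> R) (g : T -> R) (M : R) :
  (forall n, measurable_fun setT (g_ n)) -> measurable_fun setT g ->
  (forall n w, `|g_ n w| <= M) ->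
  {ae P, forall w, g_ n w @[n --> \oo] --> g w} ->
  (\int[P]_w (g_ n w)%:E)%E @[n --> \oo] --> (\int[P]_w (g w)%:E)%E.
Proof.
move=> mg_ mg gM gcvg.
have [] := @dominated_convergence _ _ _ P setT measurableT
  (fun n w => (g_ n w)%:E) (fun w => (g w)%:E) (cst M%:E) => //.
- by move=> n; apply/measurable_EFinP.
- exact/measurable_EFinP.
- apply: filterS gcvg => w gw _.
  by apply: cvg_EFin => //; exact: nearW.
- exact: finite_measure_integrable_cst.
- by apply: aeW => w n _ /=; rewrite lee_fin.
Qed.

(** On the fixed space of the standard normal, convergence of the factors is pointwise convergence
    of the integrands. It serves both at fixed [N], for refined grids, and in the final limit. *)
Lemma cvg_integral_scaled (R : realType) (f : R -> R) (M : R) (s_ : nat -> R) (s : R) :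
  continuous f -> (forall x, `|f x| <= M) -> s_ n @[n --> \oo] --> s ->
  (\int[normal_prob (0:R) 1]_x (f (s_ n * x))%:E)%E @[n --> \oo] -->
  (\int[normal_prob (0:R) 1]_x (f (s * x))%:E)%E.
Proof.
move=> cf fM scvg.
have mf (k : R) : measurable_fun [set: measurableTypeR R] (fun x : measurableTypeR R => f (k * x)).
  apply: continuous_measurable_fun => x.
  apply: (@continuous_comp _ _ _ (fun x => k * x) f); last exact: cf.
  by apply: cvgM; [exact: cvg_cst|exact: cvg_id].
apply: (@bounded_cvg_integral R _ (measurableTypeR R) (normal_prob 0 1) (fun n x => f (s_ n * x))
  (fun x => f (s * x)) M) => //.
apply: aeW => x.
apply: (cvg_comp (fun n => s_ n * x) f); last exact: cf.
by apply: cvgM => //; exact: cvg_cst.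
Qed.

Lemma scaled_normalE (R : realType) (s : R) (A : set R) : 0 < s -> measurable A ->
  normal_prob 0 s A = scaled_normal s A.
Proof.
move=> s0 mA.
have mid : measurable_fun [set: measurableTypeR R] (id : measurableTypeR R -> R) by [].
have mscale : measurable_fun [set: measurableTypeR R] (fun x : measurableTypeR R => s * x).
  exact: measurable_funM.
apply: (@law_ext_continuous R _ _ (measurableTypeR R) (measurableTypeR R)
  (normal_prob 0 s) (normal_prob 0 1) id (fun x => s * x) mid mscale _ A mA).
move=> f cf f01; rewrite (ge0_integral_normal_prob_affine 0 s0) //.
  by apply: eq_integral => x _; rewrite add0r.
by move=> x; case/andP: (f01 x).
Qed.

(** For a bounded continuous test [f], the integrals of [f (S_ n)] have two limits, one by almost
    sure convergence and one by convergence of [s_]; uniqueness of limits identifies the law. *)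
Lemma normal_ae_limit (R : realType) (d : measure_display) (T : measurableType d)
    (P : probability T R) (S_ : nat -> T -> R) (S : T -> R) (s_ : nat -> R) (s : R) :
  (forall n, measurable_fun setT (S_ n)) -> measurable_fun setT S ->
  {ae P, forall w, S_ n w @[n --> \oo] --> S w} ->
  s_ n @[n --> \oo] --> s ->
  (forall n (A : set R), measurable A -> P (S_ n @^-1` A) = scaled_normal (s_ n) A) ->
  forall A : set R, measurable A -> P (S @^-1` A) = scaled_normal s A.
Proof.
move=> mS_ mS Scvg scvg S_s.
have mscale (k : R) : measurable_fun [set: measurableTypeR R] (fun x : measurableTypeR R => k * x).
  exact: measurable_funM.
apply: (@law_ext_continuous R _ _ T (measurableTypeR R) P (normal_prob 0 1) S (fun x => s * x)
  mS (mscale s)).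
move=> f cf f01.
have mf : measurable_fun [set: R] f by exact: continuous_measurable_fun.
have fM x : `|f x| <= 1 by case/andP: (f01 x) => f0 f1; rewrite ger0_norm.
have h1 : (\int[P]_w (f (S_ n w))%:E)%E @[n --> \oo] --> (\int[P]_w (f (S w))%:E)%E.
  apply: (bounded_cvg_integral (g_ := fun n w => f (S_ n w)) (g := fun w => f (S w)) (M := 1)) => //.
  - by move=> n; apply: measurableT_comp.
  - exact: measurableT_comp.
  - apply: filterS Scvg => w Sw.
    by apply: (cvg_comp _ f Sw); exact: cf.
have h2 := cvg_integral_scaled cf fM scvg.
apply: (cvg_unique _ h1) => //.
apply: cvg_trans h2; apply: near_eq_cvg; apply: nearW => n /=.
apply/esym; apply: (@integral_law_eq R _ _ T (measurableTypeR R) P (normal_prob 0 1)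
  (S_ n) (fun x => s_ n * x) (mS_ n) (mscale (s_ n)) (S_s n) (EFin \o f)) => //.
exact/measurable_EFinP.
Qed.

(** * Moments of a variable with a scaled normal law *)

Section scaled_normal_moments.
Context (R : realType) (d : measure_display) (T : measurableType d).
Variables (P : probability T R) (X : T -> R) (s : R).
Hypothesis mX : measurable_fun setT X.
Hypothesis Xs : forall A : set R, measurable A -> P (X @^-1` A) = scaled_normal s A.

Let ms : measurable_fun [set: measurableTypeR R] (fun x : measurableTypeR R => s * x).
Proof. exact: measurable_funM. Qed.

Let transfer (g : R -> \bar R) : measurable_fun setT g ->
  (\int[P]_w g (X w) = \int[normal_prob 0 1]_x g (s * x)%R)%E.
Proof.
by move=> mg; apply: (@integral_law_eq R _ _ T (measurableTypeR R) P (normal_prob 0 1)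
  X (fun x => s * x) mX ms Xs g).
Qed.

Lemma scaled_normal_mean : (\int[P]_w (X w)%:E = 0)%E.
Proof.
rewrite (transfer (g := EFin)); last exact/measurable_EFinP.
under eq_integral do rewrite EFinM.
rewrite integralZl //; last exact: integrable_normal_id.
by rewrite integral_normal_id mule0.
Qed.

Lemma scaled_normal_second_moment : (\int[P]_w (X w ^+ 2)%:E = (s ^+ 2)%:E)%E.
Proof.
rewrite (transfer (g := fun x => (x ^+ 2)%:E)); last first.
  by apply/measurable_EFinP; exact: measurable_funX.
under eq_integral do rewrite exprMn EFinM.
rewrite ge0_integralZl //.
- by rewrite integral_normal_sqr mule1.
- by apply/measurable_EFinP; exact: measurable_funX.
- by move=> x _; rewrite lee_fin sqr_ge0.
- by rewrite lee_fin sqr_ge0.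
Qed.

Lemma scaled_normal_integrable : P.-integrable setT (EFin \o X).
Proof.
apply/integrableP; split; first exact/measurable_EFinP.
have mabs : measurable_fun [set: R] (fun x : R => `|x%:E|%E).
  by apply: measurableT_comp => //; exact/measurable_EFinP.
rewrite (transfer (g := fun x => `|x%:E|%E)) //.
have : (normal_prob (0:R) 1).-integrable setT
    (fun x : measurableTypeR R => (s%:E * x%:E)%E).
  exact: (integrableZl _ _ (@integrable_normal_id R)).
by case/integrableP.
Qed.

End scaled_normal_moments.

(** * Weighted sums of Brownian increments on a uniform grid *)

Section brownian.
Context (R : realType) (d : measure_display) (Omega : measurableType d).
Variables (P : probability Omega R) (T : R) (W : R -> {RV P >-> R}).
Hypotheses (T0 : 0 < T) (hW : brownian_motion T W).

Lemma measurable_increment (s t : R) : measurable_fun setT (increment W s t).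
Proof. by apply: measurable_funB. Qed.

Lemma brownian_grid_sum (n : nat) (c : nat -> R) : (0 < n)%N ->
  forall A : set R, measurable A ->
  P ((fun w => \sum_(i < n) c i *
        increment W (i%:R * (T / n%:R)) (i.+1%:R * (T / n%:R)) w) @^-1` A) =
  scaled_normal (Num.sqrt (\sum_(i < n) c i ^+ 2 * (T / n%:R))) A.
Proof.
move=> n0 A mA; case: hW => _ ind gauss _.
have h0 : 0 < T / n%:R by rewrite divr_gt0 // ltr0n.
pose t (i : nat) : R := i%:R * (T / n%:R).
have t_ge0 i : 0 <= t i by rewrite mulr_ge0 // ltW.
have t_leT i : (i <= n)%N -> t i <= T.
  by move=> le_in; rewrite /t mulrCA ger_pMr // ler_pdivrMr ?ltr0n // mul1r ler_nat.
have t_lt i : t i < t i.+1 by rewrite ltr_pM2r // ltr_nat.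
have dt i : t i.+1 - t i = T / n%:R by rewrite /t -mulrBl -natrB // subSnn mul1r.
have Wi : forall A : set R, measurable A ->
    P ((fun w => \sum_(i < n) c i * increment W (t i) (t i.+1) w) @^-1` A) =
    scaled_normal (Num.sqrt (\sum_(i < n) (c i * Num.sqrt (T / n%:R)) ^+ 2)) A.
  apply: (@normal_indep_sum R d Omega P n (fun i => increment W (t i) (t i.+1)) c
    (fun=> Num.sqrt (T / n%:R))).
  - by move=> i; exact: measurable_increment.
  - move=> i iltn B mB; rewrite gauss //; last exact: t_leT.
    by rewrite dt -scaled_normalE // sqrtr_gt0.
  - move=> B mB; rewrite -(ind n t _ _ (fun i => B i)) //.
    + congr (P _); apply/seteqP; split => w H i /=; first by move=> _; exact: (H i (ltn_ord i)).
      by move=> iltn; exact: (H (Ordinal iltn) Logic.I).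
    + by move=> i le_in; rewrite t_ge0 t_leT.
    + by move=> i _; exact/ltW.
rewrite Wi //; congr (scaled_normal (Num.sqrt _) A).
by apply: eq_bigr => i _; rewrite exprMn sqr_sqrtr // ltW.
Qed.

End brownian.

(** * Pathwise representation of the oscillator *)

Lemma within_continuous_mul (R : realType) (A : set R) (f g : R -> R) :
  {within A, continuous f} -> {within A, continuous g} ->
  {within A, continuous (fun x => f x * g x)}.
Proof.
move=> /subspace_continuousP cf /subspace_continuousP cg.
by apply/subspace_continuousP => x Ax; apply: cvgM; [exact: cf|exact: cg].
Qed.

(** Heine-Cantor. Compactness is used in its near-covering form, with the right neighbourhoods of 0
    as the filter on the modulus, so that local moduli merge into a single one. *)
Lemma within_continuous_uniform (R : realType) (T e : R) (w : R -> R) :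
  {within `[0, T], continuous w} -> 0 < e ->
  exists2 dlt : R, 0 < dlt & forall x y, x \in `[0, T] -> y \in `[0, T] ->
    `|x - y| < dlt -> `|w x - w y| <= e.
Proof.
move=> /subspace_continuousP cw e0.
have /compact_near_coveringP := @segment_compact R 0 T.
move=> /(_ R (0^'+ : set_system R) (fun dlt x => forall y, x \in `[0, T] -> y \in `[0, T] ->
  `|x - y| < dlt -> `|w x - w y| <= e)) [].
  move=> x xT; have /cvgrPdist_le /(_ (e / 2)) := cw x xT.
  rewrite divr_gt0 // => /(_ isT).
  rewrite near_withinE => /nbhs_ballP[r /= r0 rB].
  near=> x' dlt.
  have dltr : dlt <= r / 2 by near: dlt; apply: nbhs_right_le; exact: divr_gt0.
  have xx' : `|x - x'| < r / 2.
    by near: x'; apply: (nbhsx_ballx x (r / 2)); exact: divr_gt0.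
  move=> y x'T yT x'y.
  have -> : w x' - w y = (w x - w y) - (w x - w x') by ring.
  apply: (le_trans (ler_normB _ _)).
  rewrite [leRHS](splitr e) ?lerD //; apply: rB => //=.
  - rewrite /ball /= (_ : x - y = (x - x') + (x' - y)); last by ring.
    apply: (le_lt_trans (ler_normD _ _)).
    by rewrite [ltRHS](splitr r) ltrD // (lt_le_trans x'y).
  - rewrite /ball /=; apply: (lt_le_trans xx').
    by rewrite ler_pdivrMr // ler_pMr // ler1n.
(* The covering property gives every modulus strictly between 0 and [dlt]; the half is one of
   them. *)
move=> dlt /= dlt0 H; exists (dlt / 2); first exact: divr_gt0.
move=> x y xT yT xy; apply: (H (dlt / 2)) => //=.
- by rewrite /ball_ /= sub0r normrN gtr0_norm ?divr_gt0 // ltr_pdivrMr // ltr_pMr // ltr1n.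
- exact: divr_gt0.
Unshelve. all: by end_near. Qed.

Lemma primitive_derive (R : realType) (T : R) (f : R -> R) : 0 < T ->
  {within `[0, T], continuous f} ->
  let F t := \int[lebesgue_measure]_(s in `[0, t]) f s in
  {within `[0, T], continuous F} /\
  (forall x, x \in `]0, T[ -> is_derive x (1 : R) F (f x)).
Proof.
move=> T0 cf F.
have intf : (@lebesgue_measure R).-integrable `[0, T] (EFin \o f).
  by apply: continuous_compact_integrable => //; exact: segment_compact.
split; first exact: parameterized_integral_continuous (ltW T0) intf.
move=> x xT; move: (xT); rewrite in_itv /= => /andP[x0 xT'].
have [dF] := @continuous_FTC1_closed R f 0 x T xT' intf x0
  (within_continuous_continuous T0 cf xT).
rewrite derive1E => F'; exact: DeriveDef.
Qed.

Section oscillator_path.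
Context (R : realType) (T x1 x2 : R) (Y1 Y2 w : R -> R).
Hypotheses (T0 : 0 < T)
  (cY1 : {within `[0, T], continuous Y1}) (cY2 : {within `[0, T], continuous Y2})
  (w0 : w 0 = 0)
  (Y1E : forall t, 0 <= t <= T ->
    Y1 t = x1 + \int[lebesgue_measure]_(s in `[0, t]) Y2 s)
  (Y2E : forall t, 0 <= t <= T ->
    Y2 t = x2 + \int[lebesgue_measure]_(s in `[0, t]) (- Y1 s) + w t).

Let F1 t := \int[lebesgue_measure]_(s in `[0, t]) Y2 s.
Let F2 t := \int[lebesgue_measure]_(s in `[0, t]) (- Y1 s).

Let cNY1 : {within `[0, T], continuous (fun s => - Y1 s)}.
Proof.
by apply/subspace_continuousP => x Ax; apply: cvgN; move/subspace_continuousP : cY1; exact.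
Qed.

(* Variation of constants. *)
Let G t := cos (T - t) * (x1 + F1 t) + sin (T - t) * (x2 + F2 t).

Let G_cont : {within `[0, T], continuous G}.
Proof.
have [cF1 _] := primitive_derive T0 cY2.
have [cF2 _] := primitive_derive T0 cNY1.
have cc : continuous (fun t : R => cos (T - t)).
  move=> t; apply: (@continuous_comp _ _ _ (fun t => T - t) cos); last exact: continuous_cos.
  by apply: cvgB; [exact: cvg_cst|exact: cvg_id].
have cs : continuous (fun t : R => sin (T - t)).
  move=> t; apply: (@continuous_comp _ _ _ (fun t => T - t) sin); last exact: continuous_sin.
  by apply: cvgB; [exact: cvg_cst|exact: cvg_id].
have cD (x : R) F : {within `[0, T], continuous F} -> {within `[0, T], continuous (fun t => x + F t)}.
  move=> /subspace_continuousP cF; apply/subspace_continuousP => t tT.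
  by apply: cvgD; [exact: cvg_cst|exact: cF].
have e1 := within_continuous_mul (continuous_subspaceT cc) (cD x1 _ cF1).
have e2 := within_continuous_mul (continuous_subspaceT cs) (cD x2 _ cF2).
exact: (within_continuousD e1 e2).
Qed.

(** [G] is built from [x1 + F1] and [x2 + F2], the second being [Y2 - w]. Having shed the rough
    term, it is differentiable although [w] is not; the rotation cancels the drift and leaves only
    [w] in the derivative. *)
Let G_derive t : t \in `]0, T[ -> is_derive t (1:R) G (cos (T - t) * w t).
Proof.
move=> tT; have [_ /(_ _ tT) dF1] := primitive_derive T0 cY2.
have [_ /(_ _ tT) dF2] := primitive_derive T0 cNY1.
have tT' : 0 <= t <= T by move: tT; rewrite in_itv /= => /andP[/ltW -> /ltW ->].
apply: is_derive_eq; rewrite /GRing.scale /=.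
have -> : w t = Y2 t - x2 - F2 t by rewrite Y2E //; rewrite /F2; ring.
by rewrite (Y1E tT') /F1; ring.
Qed.

(** Continuity of the noise path is read off from the second equation. *)
Let w_cont : {within `[0, T], continuous w}.
Proof.
have [cF2 _] := primitive_derive T0 cNY1.
have wE t : t \in `[0, T] -> w t = Y2 t - x2 - F2 t.
  by rewrite in_itv /= => tT; rewrite Y2E // /F2; ring.
apply: (@subspace_eq_continuous _ _ _ (fun t => Y2 t - x2 - F2 t)).
  by move=> t /set_mem tT; exact/esym/wE.
apply: within_continuousB => //.
apply/subspace_continuousP => t tT.
by apply: cvgB; [move/subspace_continuousP : cY2; exact|exact: cvg_cst].
Qed.

(** Freezing [w] at the right endpoint, [G t + w b * sin (T - t)] has derivative
    [cos (T - t) * (w t - w b)], and the mean value theorem applies. *)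
Let local_error (a b e : R) : 0 <= a -> a <= b -> b <= T ->
  (forall t, a <= t <= b -> `|w t - w b| <= e) ->
  `|G b - G a + w b * (sin (T - b) - sin (T - a))| <= e * (b - a).
Proof.
move=> a0 ab bT we.
pose H t := G t + w b * sin (T - t).
have sub : `[a, b] `<=` `[0, T] by apply: subset_itv; rewrite bnd_simp.
have sub' t : t \in `]a, b[ -> t \in `]0, T[.
  by rewrite !in_itv /= => /andP[at' tb]; rewrite (le_lt_trans a0 at') (lt_le_trans tb bT).
have cH : {within `[a, b], continuous H}.
  apply: within_continuousD; first exact: continuous_subspaceW sub G_cont.
  apply: continuous_subspaceT => t; apply: cvgM; first exact: cvg_cst.
  apply: (@continuous_comp _ _ _ (fun t => T - t) sin); last exact: continuous_sin.
  by apply: cvgB; [exact: cvg_cst|exact: cvg_id].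
have dH t : t \in `]a, b[ -> is_derive t (1:R) H (cos (T - t) * (w t - w b)).
  move=> tab; have dG := G_derive (sub' t tab).
  by apply: is_derive_eq; rewrite /GRing.scale /=; ring.
have [c cab] := MVT_segment ab dH cH.
have -> : G b - G a + w b * (sin (T - b) - sin (T - a)) = H b - H a by rewrite /H; ring.
move=> ->; rewrite normrM (ger0_norm (_ : 0 <= b - a)) ?subr_ge0 //.
rewrite ler_wpM2r ?subr_ge0 // normrM -[leRHS]mul1r ler_pM //.
  exact: cos_max.
by apply: we; move: cab; rewrite in_itv.
Qed.

Lemma oscillator_path_cvg :
  \sum_(i < n.+1) sin (T - i%:R * (T / n.+1%:R)) *
     (w (i.+1%:R * (T / n.+1%:R)) - w (i%:R * (T / n.+1%:R))) @[n --> \oo] -->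
  Y1 T - (x1 * cos T + x2 * sin T).
Proof.
apply/cvgrPdist_le => e e0.
(* Tolerance [e / T] per unit of time: the cell errors [e / T * h] add up to [e]. *)
have [dlt dlt0 wd] := within_continuous_uniform w_cont (divr_gt0 e0 T0).
near=> n.
pose h := T / n.+1%:R; pose t (i : nat) := i%:R * h.
have h0 : 0 < h by rewrite divr_gt0.
have hd : h < dlt.
  rewrite /h ltr_pdivrMr // mulrC -ltr_pdivrMr //.
  apply: (@lt_trans _ _ n%:R); last by rewrite ltr_nat.
  by near: n; exact: nbhs_infty_gtr.
have tn : t n.+1 = T by rewrite /t /h mulrCA divff ?mulr1.
have tT i : (i <= n.+1)%N -> 0 <= t i <= T.
  by move=> le_in; rewrite /t mulr_ge0 ?(ltW h0) //= -[leRHS]tn /t ler_pM2r // ler_nat.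
have tS i : t i.+1 - t i = h by rewrite /t -mulrBl -natrB // subSnn mul1r.
have G0 : G 0 = x1 * cos T + x2 * sin T.
  by rewrite /G /F1 /F2 subr0 set_itv1 !Rintegral_set1 !addr0 !(mulrC _ x1) (mulrC _ x2).
have GT : G T = Y1 T.
  by rewrite /G subrr cos0 sin0 mul0r addr0 mul1r /F1 -Y1E // lexx ltW.
have -> : Y1 T - (x1 * cos T + x2 * sin T) -
    \sum_(i < n.+1) sin (T - t i) * (w (t i.+1) - w (t i)) =
  \sum_(i < n.+1) (G (t i.+1) - G (t i) + w (t i.+1) * (sin (T - t i.+1) - sin (T - t i))).
  rewrite -G0 -GT.
  have tele (u : nat -> R) : \sum_(i < n.+1) (u i.+1 - u i) = u n.+1 - u 0%N.
    by rewrite -(big_mkord xpredT (fun i => u i.+1 - u i)) telescope_sumr.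
  have t0 : t 0%N = 0 by rewrite /t mul0r.
  have := tele (fun i => G (t i)); rewrite tn t0 => <-.
  (* Summation by parts: both boundary terms vanish, since [sin 0 = 0] at time [T] and [w 0 = 0] at
     time 0. *)
  have e1 : \sum_(i < n.+1) (sin (T - t i.+1) * w (t i.+1) - sin (T - t i) * w (t i)) = 0.
    rewrite (tele (fun i => sin (T - t i) * w (t i))) tn t0 w0 subrr sin0.
    by rewrite mul0r mulr0 subrr.
  rewrite -[LHS]addr0 -[X in _ + X = _]e1 -sumrB -big_split /=; apply: eq_bigr => i _; ring.
apply: (le_trans (ler_norm_sum _ _ _)).
apply: (@le_trans _ _ (\sum_(i < n.+1) e / T * h)); last first.
  rewrite sumr_const card_ord -mulr_natr -mulrA /h divfK // divfK // gt_eqF //.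
apply: ler_sum => i _; rewrite -(tS i).
have /andP[ti0 tiT] := tT i (ltnW (ltn_ord i)).
have /andP[ti0' tiT'] := tT i.+1 (ltn_ord i).
have tiS : t i <= t i.+1 by rewrite -subr_ge0 tS ltW.
apply: local_error => // s /andP[tis sti].
apply: wd; rewrite ?in_itv /= ?ti0' ?tiT' //.
  by rewrite (le_trans ti0 tis) (le_trans sti tiT').
rewrite ler0_norm ?subr_le0 // opprB; apply: le_lt_trans hd.
by rewrite -(tS i) lerB.
Unshelve. all: by end_near. Qed.

End oscillator_path.

(** * Calculus estimates *)

Section calculus.
Context (R : realType).
Implicit Types (F f : R -> R) (a b K L x y u : R).

Lemma derive_bound F f a b K : a <= b ->
  (forall x, is_derive x (1 : R) F (f x)) ->
  (forall x, a <= x <= b -> `|f x| <= K) -> `|F b - F a| <= K * (b - a).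
Proof.
move=> ab dF fK.
have cF : {within `[a, b], continuous F}.
  by apply: derivable_within_continuous => x _; case: (dF x).
have [c cab ->] := MVT_segment ab (fun x _ => dF x) cF.
rewrite normrM (ger0_norm (_ : 0 <= b - a)) ?subr_ge0 //.
by rewrite ler_wpM2r ?subr_ge0 // fK //; move: cab; rewrite in_itv.
Qed.

Lemma lipschitz_of_derive F f L x y :
  (forall x, is_derive x (1 : R) F (f x)) -> (forall x, `|f x| <= L) ->
  `|F x - F y| <= L * `|x - y|.
Proof.
move=> dF fL; have [xy|yx] := leP x y.
  rewrite distrC (distrC x) (ger0_norm (_ : 0 <= y - x)) ?subr_ge0 //.
  exact: (derive_bound xy dF).
by rewrite (gtr0_norm (_ : 0 < x - y)) ?subr_gt0 //; apply: (derive_bound (ltW yx) dF).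
Qed.

(** On a cell starting at [t r], the function [F x - f (t r) * x] has derivative at most [L * dlt],
    so each of the [m] cells contributes at most [L * dlt ^+ 2]. *)
Lemma riemann_sum_error F f a b L (m : nat) : a <= b -> (0 < m)%N ->
  (forall x, is_derive x (1 : R) F (f x)) ->
  (forall x y, `|f x - f y| <= L * `|x - y|) ->
  `|F b - F a - \sum_(r < m) f (a + r%:R * ((b - a) / m%:R)) * ((b - a) / m%:R)|
    <= L * (b - a) ^+ 2 / m%:R.
Proof.
move=> ab m0 dF fL; set dlt := (b - a) / m%:R.
have mR : (0 : R) < m%:R by rewrite ltr0n.
have d0 : 0 <= dlt by rewrite divr_ge0 ?subr_ge0 // ltW.
pose t (r : nat) := a + r%:R * dlt.
have -> : F b - F a = \sum_(r < m) (F (t r.+1) - F (t r)).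
  rewrite -(big_mkord xpredT (fun r => F (t r.+1) - F (t r))) telescope_sumr //.
  by rewrite /t mul0r addr0 /dlt mulrCA divff ?gt_eqF // mulr1 (addrC a) subrK.
rewrite -sumrB; apply: (le_trans (ler_norm_sum _ _ _)).
have L0 : 0 <= L.
  have := fL 0 1; rewrite sub0r normrN normr1 mulr1; exact: le_trans.
apply: (@le_trans _ _ (\sum_(r < m) L * dlt ^+ 2)); last first.
  rewrite sumr_const card_ord -mulr_natr /dlt le_eqVlt; apply/orP; left; apply/eqP.
  by field; rewrite gt_eqF.
apply: ler_sum => r _.
have tS : t r.+1 - t r = dlt by rewrite /t -natr1; ring.
have tle : t r <= t r.+1 by rewrite -subr_ge0 tS.
pose H x := F x - f (t r) * x.
have dH x : is_derive x (1:R) H (f x - f (t r)).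
  by apply: is_derive_eq; rewrite /GRing.scale /=; ring.
have := @derive_bound H (fun x => f x - f (t r)) (t r) (t r.+1) (L * dlt) tle dH.
have -> : H (t r.+1) - H (t r) = F (t r.+1) - F (t r) - f (t r) * dlt by rewrite -tS /H; ring.
rewrite tS -mulrA -expr2; apply => x /andP[rx xr].
apply: (le_trans (fL _ _)); rewrite ler_wpM2l // ger0_norm ?subr_ge0 //.
by rewrite -tS lerB.
Qed.

Lemma riemann_sum_cvg F f a b L : a <= b ->
  (forall x, is_derive x (1 : R) F (f x)) ->
  (forall x y, `|f x - f y| <= L * `|x - y|) ->
  \sum_(r < m.+1) f (a + r%:R * ((b - a) / m.+1%:R)) * ((b - a) / m.+1%:R) @[m --> \oo]
    --> F b - F a.
Proof.
move=> ab dF fL; apply/cvgrPdist_le => e e0; near=> m.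
apply: (le_trans (riemann_sum_error ab (ltn0Sn m) dF fL)).
rewrite ler_pdivrMr // [leRHS]mulrC -ler_pdivrMr //.
apply: (@le_trans _ _ m%:R); last by rewrite ler_nat.
by near: m; exact: nbhs_infty_ger.
Unshelve. all: by end_near. Qed.

(** One rung of the Taylor ladder for sine and cosine below. The gain [1 / (n + 1)] of integration
    is given up, which keeps all constants equal to 1. *)
Lemma derive_power_bound F f K (n : nat) x : 0 <= x -> 0 <= K ->
  (forall x, is_derive x (1 : R) F (f x)) -> F 0 = 0 ->
  (forall t, 0 <= t -> `|f t| <= K * t ^+ n) -> `|F x| <= K * x ^+ n.+1.
Proof.
move=> x0 K0 dF F0 fK.
have := @derive_bound F f 0 x (K * x ^+ n) x0 dF.
rewrite F0 !subr0 -mulrA -exprSr; apply => t /andP[t0 tx].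
by apply: (le_trans (fK t t0)); rewrite ler_wpM2l // lerXn2r // nnegrE.
Qed.

Lemma sin_bound x : 0 <= x -> `|sin x| <= x.
Proof.
move=> x0; have := @derive_power_bound sin cos 1 0 x x0 ler01 (@is_derive_sin R) (sin0 R).
rewrite mul1r expr1; apply => t _; rewrite mul1r expr0; exact: cos_max.
Qed.

Lemma cos_bound x : 0 <= x -> `|cos x - 1| <= x ^+ 2.
Proof.
move=> x0.
have := @derive_power_bound (fun x => cos x - 1) (fun x => - sin x) 1 1 x x0 ler01.
rewrite mul1r; apply.
- by move=> t; apply: is_derive_eq; rewrite subr0.
- by rewrite cos0 subrr.
- by move=> t t0; rewrite normrN mul1r expr1; exact: sin_bound.
Qed.

Lemma sin_taylor x : 0 <= x -> `|sin x - x| <= x ^+ 3.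
Proof.
move=> x0.
have := @derive_power_bound (fun x => sin x - x) (fun x => cos x - 1) 1 2 x x0 ler01.
rewrite mul1r; apply.
- by rewrite sin0 subrr.
- by move=> t t0; rewrite mul1r; exact: cos_bound.
Qed.

Lemma cos_taylor x : 0 <= x -> `|cos x - 1 + x ^+ 2 / 2| <= x ^+ 4.
Proof.
move=> x0.
have := @derive_power_bound (fun x => cos x - 1 + x ^+ 2 / 2) (fun x => x - sin x) 1 3 x x0 ler01.
rewrite mul1r; apply.
- by move=> t; apply: is_derive_eq; rewrite /GRing.scale /=; field.
- by rewrite cos0 subrr expr0n mul0r addr0.
- by move=> t t0; rewrite mul1r distrC; exact: sin_taylor.
Qed.

Lemma sinB_taylor x u : 0 <= u <= 1 -> `|sin (x - u) - sin x + u * cos x| <= 2 * u ^+ 2.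
Proof.
move=> /andP[u0 u1]; rewrite sinB.
have -> : sin x * cos u - cos x * sin u - sin x + u * cos x =
  sin x * (cos u - 1) - cos x * (sin u - u) by ring.
apply: (le_trans (ler_normB _ _)); rewrite !normrM.
have h1 : `|sin x| * `|cos u - 1| <= 1 * u ^+ 2.
  by rewrite ler_pM // ?sin_max // cos_bound.
have h2 : `|cos x| * `|sin u - u| <= 1 * u ^+ 2.
  rewrite ler_pM // ?cos_max //; apply: (le_trans (sin_taylor u0)).
  by rewrite [leLHS]exprS ler_piMl // exprn_ge0.
lra.
Qed.

Lemma cos_double x : cos (2 * x) = 1 - 2 * sin x ^+ 2.
Proof. by rewrite mulr_natl cos_mulr2n cos2sin2 -mulr_natl; ring. Qed.

End calculus.

(** * The symplectic beta method *)

Section discrete_oscillator.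
Context (R : realType).

(* First components are the discrete sine solving
   [s_{k+2} = (2 - h^2 / D) s_{k+1} - s_k], second ones its difference quotients. *)
Fixpoint discrete_osc (h D : R) (k : nat) : R * R :=
  if k is j.+1 then
    let sc := discrete_osc h D j in
    let s := sc.1 + h * sc.2 in (s, sc.2 - h / D * s)
  else (0, D^-1).

Variables (h kappa : R).
Hypotheses (h0 : 0 < h) (h1 : h <= 1) (k01 : 0 <= kappa <= 1).
Let D := 1 + kappa * h ^+ 2.
Let sk k := (discrete_osc h D k).1.
Let ck k := (discrete_osc h D k).2.
Let rk (k : nat) := sk k - sin (k%:R * h).
Let qk (k : nat) := ck k - (sin (k.+1%:R * h) - sin (k%:R * h)) / h.

Let hN0 : h != 0. Proof. by rewrite gt_eqF. Qed.

Let D1 : 1 <= D.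
Proof. by rewrite lerDl mulr_ge0 ?sqr_ge0 //; case/andP: k01. Qed.

Let D0 : 0 < D. Proof. exact: lt_le_trans ltr01 D1. Qed.

Let DN0 : D != 0. Proof. by rewrite gt_eqF. Qed.

Let invD : `|D^-1 - 1| <= h ^+ 2.
Proof.
have -> : D^-1 - 1 = - (kappa * h ^+ 2 / D) by rewrite /D; field.
case/andP: k01 => k0 k1.
rewrite normrN ger0_norm; last first.
  by apply: divr_ge0; [rewrite mulr_ge0 ?sqr_ge0|exact: ltW].
rewrite ler_pdivrMr //.
apply: (@le_trans _ _ (h ^+ 2)); first by rewrite ler_piMl ?sqr_ge0.
by rewrite ler_peMr ?sqr_ge0.
Qed.

Let hD_le : `|h / D| <= h.
Proof.
by rewrite gtr0_norm ?divr_gt0 // ler_pdivrMr // ler_peMr // ltW.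
Qed.

(** Local truncation error. The exact sine has second difference
    [(2 * cos h - 2) * sin (k.+1%:R * h)] where the scheme has factor [- h ^+ 2 / D]; the bound
    concerns the mismatch divided by [h]. Of the constant 3, one unit comes from [D^-1] and two from
    [cos_taylor]. *)
Let tau : `|h / D + (2 * cos h - 2) / h| <= 3 * h ^+ 3.
Proof.
have -> : h / D + (2 * cos h - 2) / h =
  h * (D^-1 - 1) + (cos h - 1 + h ^+ 2 / 2) * (2 / h) 
  by field; rewrite ?hN0 ?DN0.
apply: (le_trans (ler_normD _ _)); rewrite !normrM (gtr0_norm h0).
have p1 : h * `|D^-1 - 1| <= h * h ^+ 2 by rewrite ler_wpM2l // ltW.
have p2 : `|cos h - 1 + h ^+ 2 / 2| * (`|2| * `|h^-1|) <= h ^+ 4 * (2 / h).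
  by rewrite normr_nat normfV (gtr0_norm h0) ler_wpM2r ?divr_ge0 ?(ltW h0) // cos_taylor // ltW.
have p3 : h ^+ 4 * (2 / h) = 2 * h ^+ 3 by field.
have p4 : h * h ^+ 2 = h ^+ 3 by rewrite -exprS.
lra.
Qed.

Let r_step k : rk k.+1 = rk k + h * qk k.
Proof. by rewrite /rk /qk /sk /ck /=; field. Qed.

Let q_step k : qk k.+1 = qk k - h / D * rk k.+1
  - (h / D + (2 * cos h - 2) / h) * sin (k.+1%:R * h).
Proof.
have e1 : k.+2%:R * h = k.+1%:R * h + h by rewrite -natr1; ring.
have e2 : k%:R * h = k.+1%:R * h - h by rewrite -natr1; ring.
rewrite /rk /qk /sk /ck /= e1 e2 sinD sinB; by field; rewrite ?hN0 ?DN0.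
Qed.

(** The errors [rk] and [qk] obey the recurrence of the scheme itself, forced by the truncation
    error. As [h * (1 + h) <= 2 * h], a step multiplies the bound by at most [1 + 2 * h] and adds
    [3 * h ^+ 3]; the term [3 * h ^+ 2] covers the initial error of [qk]. *)
Let gronwall k :
  let B := (1 + 2 * h) ^+ k * (3 * h ^+ 2 + k%:R * (3 * h ^+ 3)) in
  `|rk k| <= B /\ `|qk k| <= B.
Proof.
elim: k => [|k [IHr IHq]] /=.
  rewrite expr0 mul1r !mul0r addr0; split.
    by rewrite /rk /sk /= mul0r sin0 subrr normr0 mulr_ge0 ?sqr_ge0.
  rewrite /qk /ck /= mul0r sin0 subr0 mul1r.
  have -> : D^-1 - sin h / h = (D^-1 - 1) - (sin h - h) / h by field; rewrite ?hN0 ?DN0.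
  apply: (le_trans (ler_normB _ _)).
  have p : `|(sin h - h) / h| <= h ^+ 2.
    rewrite normrM normfV (gtr0_norm h0) ler_pdivrMr // -exprSr.
    by apply: sin_taylor; exact: ltW.
  have := sqr_ge0 h; have := invD; lra.
set B := (1 + 2 * h) ^+ k * _ in IHr IHq *.
have B0 : 0 <= B by apply: le_trans IHr.
have g1 : 1 <= (1 + 2 * h) ^+ k.+1.
  by apply: exprn_ege1; have := ltW h0; lra.
have -> : (1 + 2 * h) ^+ k.+1 * (3 * h ^+ 2 + k.+1%:R * (3 * h ^+ 3)) =
  (1 + 2 * h) * B + (1 + 2 * h) ^+ k.+1 * (3 * h ^+ 3).
  by rewrite /B exprS -natr1; ring.
have h3 : 0 <= 3 * h ^+ 3 by rewrite mulr_ge0 // exprn_ge0 // ltW.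
have last_le : 3 * h ^+ 3 <= (1 + 2 * h) ^+ k.+1 * (3 * h ^+ 3) by rewrite ler_peMl.
have rB : `|rk k.+1| <= (1 + h) * B.
  rewrite r_step; apply: (le_trans (ler_normD _ _)).
  by rewrite normrM (gtr0_norm h0) mulrDl mul1r lerD // ler_wpM2l // ltW.
split.
  apply: (le_trans rB); have : 0 <= h * B by rewrite mulr_ge0 // ltW.
  by lra.
rewrite q_step.
apply: (le_trans (ler_normB _ _)).
have t1 : `|(h / D + (2 * cos h - 2) / h) * sin (k.+1%:R * h)| <= 3 * h ^+ 3.
  by rewrite normrM -[leRHS]mulr1 ler_pM // sin_max.
have t2 : `|qk k - h / D * rk k.+1| <= B + h * ((1 + h) * B).
  apply: (le_trans (ler_normB _ _)); by rewrite lerD // normrM ler_pM.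
have t3 : h * ((1 + h) * B) <= 2 * h * B.
  rewrite mulrA ler_wpM2r //; have := h1; have := h0; nra.
lra.
Qed.

(** Over a time horizon [T], [(1 + 2 * h) ^+ k] stays below [expR (2 * T)], and the accumulated [k]
    local errors cost one power of [h]. *)
Lemma discrete_sin_error (T : R) (k : nat) : k%:R * h <= T ->
  `|(discrete_osc h D k).1 - sin (k%:R * h)| <= 3 * (1 + T) * expR (2 * T) * h ^+ 2.
Proof.
move=> khT; have [r _] := gronwall k; apply: (le_trans r).
have T0 : 0 <= T by apply: le_trans khT; rewrite mulr_ge0 // ltW.
have e1 : (1 + 2 * h) ^+ k <= expR (2 * T).
  apply: (@le_trans _ _ (expR (2 * h) ^+ k)).
    by rewrite lerXn2r ?nnegrE ?expR_ge0 ?expR_ge1Dx // addr_ge0 // mulr_ge0 // ltW.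
  by rewrite -expRM_natr ler_expR -mulrA ler_wpM2l // mulrC.
have e2 : 3 * h ^+ 2 + k%:R * (3 * h ^+ 3) <= 3 * (1 + T) * h ^+ 2.
  have -> : 3 * h ^+ 2 + k%:R * (3 * h ^+ 3) = 3 * (1 + k%:R * h) * h ^+ 2 by ring.
  by rewrite ler_wpM2r ?sqr_ge0 // ler_wpM2l // lerD2l.
have -> : 3 * (1 + T) * expR (2 * T) * h ^+ 2 = expR (2 * T) * (3 * (1 + T) * h ^+ 2) by ring.
have hge0 := ltW h0.
apply: ler_pM => //.
  by apply: exprn_ge0; lra.
by apply: addr_ge0; rewrite ?mulr_ge0 // mulr_ge0 ?exprn_ge0.
Qed.

End discrete_oscillator.

Lemma mul_mx2_col2 (R : realType) (a b c d x y : R) :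
  mx2 a b c d *m col2 x y = col2 (a * x + b * y) (c * x + d * y).
Proof.
apply/matrixP => i j; rewrite !mxE !big_ord_recl big_ord0 addr0 !mxE /=.
by case: (i == 0).
Qed.

(** In the coordinates [(s, c)], with [s + (1 - beta) * h * c] as first component and [c] as second,
    [beta_matrix] acts as an explicit two-stage step: [s] moves by [h * c], then [c] moves by
    [- h / D] times the new [s]. This is the step of [discrete_osc]. *)
Lemma beta_noise_power (R : realType) (beta h : R) (j : nat) :
  0 < h -> 1 + beta * (1 - beta) * h ^+ 2 != 0 ->
  let sc := discrete_osc h (1 + beta * (1 - beta) * h ^+ 2) j in
  beta_matrix beta h ^+ j *m beta_noise beta h =
    col2 (sc.1 + (1 - beta) * h * sc.2) sc.2.
Proof.
move=> h0 D0 /=; elim: j => [|j IH].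
  rewrite expr0 mul1mx /beta_noise; apply/matrixP => i k; rewrite !mxE /=.
  by case: (i == 0); rewrite ?mulr1 //; ring.
rewrite exprS -mulmxE -mulmxA IH /beta_matrix -scalemxAl mul_mx2_col2 /=.
by apply/matrixP => i k; rewrite !mxE; case: (i == 0); field.
Qed.

Section beta_method.
Context (R : realType) (d : measure_display) (Omega : measurableType d).
Variables (P : probability Omega R) (W : R -> {RV P >-> R}).
Variables (alpha beta h : R) (X0 : 'cV[R]_2).

Lemma beta_methodE (N : nat) (w : Omega) :
  beta_method alpha beta h X0 W N w = beta_matrix beta h ^+ N *m X0 +
  \sum_(j < N) (alpha * increment W (j%:R * h) (j.+1%:R * h) w) *:
    (beta_matrix beta h ^+ (N - j.+1) *m beta_noise beta h).
Proof.
elim: N => [|N IH] /=; first by rewrite big_ord0 addr0 expr0 mul1mx.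
rewrite IH mulmxDr mulmxA mulmxE -exprS -addrA; congr (_ + _).
rewrite big_ord_recr /= subnn expr0 mul1mx; congr (_ + _).
rewrite mulmx_sumr; apply: eq_bigr => j _.
by rewrite -scalemxAr mulmxA mulmxE -exprS subSn.
Qed.

Definition noise_kernel (D : R) (j : nat) : R :=
  let sc := discrete_osc h D j in sc.1 + (1 - beta) * h * sc.2.

Lemma beta_method_fst (N : nat) (w : Omega) :
  0 < h -> 1 + beta * (1 - beta) * h ^+ 2 != 0 ->
  beta_method alpha beta h X0 W N w 0 0 = (beta_matrix beta h ^+ N *m X0) 0 0 +
  alpha * \sum_(j < N) noise_kernel (1 + beta * (1 - beta) * h ^+ 2) (N - j.+1) *
    increment W (j%:R * h) (j.+1%:R * h) w.
Proof.
move=> h0 D0; rewrite beta_methodE mxE summxE mulr_sumr; congr (_ + _).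
apply: eq_bigr => j _; rewrite mxE beta_noise_power // mxE /=.
by rewrite /noise_kernel; ring.
Qed.

End beta_method.

(** * Variance asymptotics *)

Section variance_asymptotics.
Context (R : realType).
Variables (T beta : R).
Hypotheses (T0 : 0 < T) (b01 : 0 <= beta <= 1).

Let K : R := 3 * (1 + T) * expR (2 * T).

Let K0 : 0 <= K.
Proof. by rewrite mulr_ge0 ?expR_ge0 // mulr_ge0 // addr_ge0 // ltW. Qed.

Let kappa01 : 0 <= beta * (1 - beta) <= 1.
Proof.
case/andP: b01 => b0 b1; apply/andP; split; first by rewrite mulr_ge0 // subr_ge0.
by have := sqr_ge0 beta; nra.
Qed.

Lemma noise_kernel_error (h : R) (j : nat) : 0 < h -> h <= 1 -> j.+1%:R * h <= T ->
  `|noise_kernel beta h (1 + beta * (1 - beta) * h ^+ 2) j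
    - ((1 - beta) * sin (j.+1%:R * h) + beta * sin (j%:R * h))| <= K * h ^+ 2.
Proof.
move=> h0 h1 jT; case/andP: b01 => b0 b1.
have e1 := discrete_sin_error h0 h1 kappa01 jT.
have jT' : j%:R * h <= T.
  by apply: le_trans jT; rewrite ler_wpM2r ?(ltW h0) // ler_nat.
have e2 := discrete_sin_error h0 h1 kappa01 jT'.
rewrite -/K in e1 e2; set D := 1 + _ in e1 e2 *.
have -> : noise_kernel beta h D j - ((1 - beta) * sin (j.+1%:R * h) + beta * sin (j%:R * h))
  = (1 - beta) * ((discrete_osc h D j.+1).1 - sin (j.+1%:R * h)) +
    beta * ((discrete_osc h D j).1 - sin (j%:R * h)).
  by rewrite /noise_kernel /=; ring.
apply: (le_trans (ler_normD _ _)); rewrite !normrM (ger0_norm b0) ger0_norm ?subr_ge0 //.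
have -> : K * h ^+ 2 = (1 - beta) * (K * h ^+ 2) + beta * (K * h ^+ 2) by ring.
by rewrite lerD // ler_wpM2l // subr_ge0.
Qed.

(** A closed-form antiderivative in [s] of [(g - sin (T - s)) ^+ 2]. Variances are expressed by its
    increments, so the asymptotics need only mean value arguments. *)
Definition kernel_primitive (g s : R) : R :=
  g ^+ 2 * s - 2 * g * cos (T - s) + s / 2 + sin (2 * (T - s)) / 4.

Lemma is_derive_kernel_primitive (g s : R) :
  is_derive s (1 : R) (kernel_primitive g) ((g - sin (T - s)) ^+ 2).
Proof.
rewrite /kernel_primitive; apply: is_derive_eq.
by rewrite /GRing.scale /= cos_double; field.
Qed.

Lemma kernel_lipschitz (g x y : R) :
  `|(g - sin (T - x)) ^+ 2 - (g - sin (T - y)) ^+ 2| <= 2 * (`|g| + 1) * `|x - y|.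
Proof.
apply: (@lipschitz_of_derive R (fun s => (g - sin (T - s)) ^+ 2)
  (fun s => 2 * (g - sin (T - s)) * cos (T - s))).
  by move=> s; apply: is_derive_eq; rewrite /GRing.scale /=; ring.
move=> s; rewrite !normrM normr_nat -[leRHS]mulr1 ler_pM ?mulr_ge0 ?cos_max //.
rewrite ler_wpM2l // (le_trans (ler_normB _ _)) // lerD2l; exact: sin_max.
Qed.

(** The kernel index is reversed because the noise of step [j] is propagated by the [N - j.+1] later
    steps. *)
Definition block_variance (N j : nat) : R :=
  let h := T / N%:R in
  let g := noise_kernel beta h (1 + beta * (1 - beta) * h ^+ 2) (N - j.+1) in
  kernel_primitive g (j.+1%:R * h) - kernel_primitive g (j%:R * h).

Let c : R := (3 * beta ^+ 2 - 3 * beta + 1) / 3.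

(** Let [a] be the kernel difference and [b] its linear model. Then [a - b] is of order [h ^+ 2] and
    [b] of order [h], so [a ^+ 2 - b ^+ 2 = (a - b) * (a - b + 2 * b)] is of order [h ^+ 3] on a
    cell of length [h]. In [K + 4], [K] bounds the kernel error and each of the two sine expansions
    adds 2; [K + 6] includes [2 * b]. *)
Lemma block_variance_error (N j : nat) : let h := T / N%:R in
  h <= 1 -> (j < N)%N ->
  `|block_variance N j - c * h ^+ 3 * cos (T - j%:R * h) ^+ 2| <= (K + 4) * (K + 6) * h ^+ 4.
Proof.
move=> h h1 jN; case/andP: (b01) => b0 b1.
have N0 : (0 : R) < N%:R by rewrite ltr0n (leq_ltn_trans _ jN).
have h0 : 0 < h by rewrite divr_gt0.
have hge0 := ltW h0.
rewrite /block_variance -/h; set g := noise_kernel _ _ _ _.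
set t := j%:R * h; set x := T - t.
have tS : j.+1%:R * h = t + h by rewrite -natr1 /t; ring.
have TN : T = N%:R * h by rewrite /h mulrCA divff ?mulr1 ?gt_eqF.
have xE : (N - j.+1).+1%:R * h = x.
  by rewrite -subSn // subSS natrB 1?ltnW // mulrBl -TN.
have xhE : (N - j.+1)%:R * h = x - h by rewrite natrB // mulrBl -TN tS /x; ring.
have gE : `|g - ((1 - beta) * sin x + beta * sin (x - h))| <= K * h ^+ 2.
  rewrite -xE -[sin (_ - h)]/(sin (_ - h)) xE -xhE -{1}xE; apply: noise_kernel_error => //.
  by rewrite xE /x gerBl mulr_ge0.
(* The cubic term is a primitive of [- b ^+ 2], and over the cell it changes by exactly minus the
   leading term, [- c * h ^+ 3 * cos x ^+ 2]. *)
pose J s := kernel_primitive g s + cos x ^+ 2 * (beta * h - (s - t)) ^+ 3 / 3.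
have dJ s : is_derive s (1:R) J ((g - sin (T - s)) ^+ 2 - (cos x * (beta * h - (s - t))) ^+ 2).
  have dk := is_derive_kernel_primitive g s.
  by apply: is_derive_eq; rewrite /GRing.scale /=; field.
have -> : kernel_primitive g (j.+1%:R * h) - kernel_primitive g t -
    c * h ^+ 3 * cos x ^+ 2 = J (t + h) - J t.
  by rewrite tS /J /c; field.
have := @derive_bound R J _ t (t + h) ((K + 4) * (K + 6) * h ^+ 3) _ dJ.
rewrite lerDl hge0 => /(_ isT); rewrite (_ : t + h - t = h); last by ring.
have -> : (K + 4) * (K + 6) * h ^+ 4 = (K + 4) * (K + 6) * h ^+ 3 * h by ring.
apply => s /andP[ts sth].
set u := s - t.
have u0 : 0 <= u by rewrite subr_ge0.
have uh : u <= h by rewrite lerBlDl.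
have TsE : T - s = x - u by rewrite /x /u; ring.
pose a := g - sin (T - s); pose b := - cos x * (beta * h - u).
have ab : `|a - b| <= (K + 4) * h ^+ 2.
  have -> : a - b = (g - ((1 - beta) * sin x + beta * sin (x - h)))
    + beta * (sin (x - h) - sin x + h * cos x) - (sin (x - u) - sin x + u * cos x).
    by rewrite /a /b TsE; ring.
  apply: (le_trans (ler_normB _ _)).
  have p1 : `|sin (x - u) - sin x + u * cos x| <= 2 * h ^+ 2.
    apply: (le_trans (sinB_taylor x _)); first by rewrite u0 (le_trans uh h1).
    by rewrite ler_wpM2l // lerXn2r // nnegrE.
  have p2 : `|beta * (sin (x - h) - sin x + h * cos x)| <= 2 * h ^+ 2.
    rewrite normrM (ger0_norm b0) -[leRHS]mul1r ler_pM //.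
    by apply: sinB_taylor; rewrite hge0.
  have := ler_normD (g - ((1 - beta) * sin x + beta * sin (x - h)))
     (beta * (sin (x - h) - sin x + h * cos x)).
  lra.
have bh : `|b| <= h.
  rewrite /b normrM normrN -[leRHS]mul1r ler_pM ?cos_max //.
  rewrite ler_norml; apply/andP; split; nra.
have -> : (g - sin (T - s)) ^+ 2 - (cos x * (beta * h - u)) ^+ 2 = (a - b) * (a - b + 2 * b).
  by rewrite /a /b; ring.
rewrite normrM.
have p3 : `|a - b + 2 * b| <= (K + 6) * h.
  apply: (le_trans (ler_normD _ _)); rewrite normrM normr_nat.
  have : (K + 4) * h ^+ 2 <= (K + 4) * h.
    by rewrite ler_wpM2l ?addr_ge0 // expr2 ler_piMl.
  lra.
have -> : (K + 4) * (K + 6) * h ^+ 3 = ((K + 4) * h ^+ 2) * ((K + 6) * h) by ring.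
by rewrite ler_pM.
Qed.

Lemma variance_error : exists C : R, forall N : nat, let h := T / N%:R in
  (0 < N)%N -> h <= 1 ->
  `|\sum_(j < N) block_variance N j -
     (3 * beta ^+ 2 - 3 * beta + 1) * (T / 6 + sin (2 * T) / 12) * h ^+ 2| <= C * h ^+ 3.
Proof.
(* First summand: [N] block errors of order [h ^+ 4], with [N * h = T]. Second: the left-endpoint
   Riemann error [2 * T * h] of the squared cosine, scaled by [c * h ^+ 2]. *)
exists (T * ((K + 4) * (K + 6)) + `|c| * (2 * T)) => N h N0 h1.
have NR : (0 : R) < N%:R by rewrite ltr0n.
have h0 : 0 < h by rewrite divr_gt0.
pose Psi (s : R) : R := s / 2 - sin (2 * (T - s)) / 4.
have dPsi s : is_derive s (1:R) Psi (cos (T - s) ^+ 2).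
  apply: is_derive_eq; rewrite /GRing.scale /= cos_double cos2sin2; by field.
have lip x y : `|cos (T - x) ^+ 2 - cos (T - y) ^+ 2| <= 2 * `|x - y|.
  apply: (@lipschitz_of_derive R (fun s => cos (T - s) ^+ 2)
    (fun s => 2 * cos (T - s) * sin (T - s))).
    by move=> s; apply: is_derive_eq; rewrite /GRing.scale /=; ring.
  move=> s; rewrite !normrM normr_nat -[leRHS]mulr1 ler_pM ?mulr_ge0 ?sin_max //.
  by rewrite -[leRHS]mulr1 ler_wpM2l // cos_max.
have := riemann_sum_error (ltW T0) N0 dPsi lip.
rewrite subr0 -/h.
under eq_bigr do rewrite add0r.
have -> : 2 * T ^+ 2 / N%:R = 2 * T * h by rewrite /h; field; rewrite gt_eqF.
set S := \sum_(r < N) _ => SE.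
have -> : \sum_(j < N) block_variance N j -
     (3 * beta ^+ 2 - 3 * beta + 1) * (T / 6 + sin (2 * T) / 12) * h ^+ 2 =
  (\sum_(j < N) (block_variance N j - c * h ^+ 3 * cos (T - j%:R * h) ^+ 2))
  - c * h ^+ 2 * (Psi T - Psi 0 - S).
  rewrite [X in _ = X - _]sumrB.
  have -> : \sum_(i < N) c * h ^+ 3 * cos (T - i%:R * h) ^+ 2 = c * h ^+ 2 * S.
    by rewrite /S mulr_sumr; apply: eq_bigr => i _; ring.
  rewrite /Psi subrr mulr0 sin0 !subr0 /c; by field.
apply: (le_trans (ler_normB _ _)); rewrite mulrDl lerD //.
  apply: (le_trans (ler_norm_sum _ _ _)).
  apply: (@le_trans _ _ (\sum_(j < N) (K + 4) * (K + 6) * h ^+ 4)).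
    by apply: ler_sum => j _; apply: block_variance_error.
  rewrite sumr_const card_ord -mulr_natr le_eqVlt; apply/orP; left; apply/eqP.
  by rewrite /h; field; rewrite gt_eqF.
rewrite (normrM (c * h ^+ 2)) (normrM c) (ger0_norm (_ : 0 <= h ^+ 2)) ?exprn_ge0 ?(ltW h0) //.
have -> : `|c| * (2 * T) * h ^+ 3 = `|c| * h ^+ 2 * (2 * T * h) by ring.
by rewrite ler_wpM2l // mulr_ge0 // exprn_ge0 // ltW.
Qed.

End variance_asymptotics.

(** * Law of the error *)

Lemma sum_blocks (R : realType) (N M : nat) (F : nat -> R) :
  \sum_(i < N * M) F i = \sum_(j < N) \sum_(r < M) F (j * M + r)%N.
Proof.
rewrite -(big_mkord xpredT F) big_nat_mul big_mkord.
apply: eq_bigr => j _; rewrite -{1}(add0n (j * M)%N) big_addn mulSn addnK big_mkord.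
by apply: eq_bigr => r _; rewrite addnC.
Qed.

Section error_law.
Context (R : realType) (d : measure_display) (Omega : measurableType d).
Variables (P : probability Omega R) (alpha T beta : R) (X0 : 'cV[R]_2).
Variables (W : R -> {RV P >-> R}) (X : R -> Omega -> 'cV[R]_2).
Hypotheses (T0 : 0 < T) (b01 : 0 <= beta <= 1).
Hypotheses (hW : brownian_motion T W) (hX : oscillator_solution T alpha X0 W X).

(** The pathwise lemma is applied with noise path [alpha * increment W 0 t], which is 0 at time 0
    for every [w]. *)
Lemma solution_cvg : {ae P, forall w,
  \sum_(i < n.+1) sin (T - i%:R * (T / n.+1%:R)) *
     (alpha * increment W (i%:R * (T / n.+1%:R)) (i.+1%:R * (T / n.+1%:R)) w) @[n --> \oo] -->
  X T w 0 0 - (X0 0 0 * cos T + X0 1 0 * sin T)}.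
Proof.
case: hX => _ cX eX; apply: filterS2 cX eX => w cX eX.
have := @oscillator_path_cvg R T (X0 0 0) (X0 1 0) (fun t => X t w 0 0) (fun t => X t w 1 0)
  (fun t => alpha * increment W 0 t w) T0 (cX 0) (cX 1).
rewrite {1}/increment subrr mulr0 => /(_ erefl) path.
apply: cvg_trans (path _ _).
- apply: near_eq_cvg; apply: nearW => n; apply: eq_bigr => i _.
  by rewrite -mulrBr /increment opprB addrA subrK.
- move=> t tT; rewrite (eX t 0 tT) /col2 mxE /= mulr0 mul0r addr0; congr (_ + _).
  apply: eq_Rintegral => s _.
  by rewrite mxE !big_ord_recl big_ord0 !mxE /= mul0r add0r mul1r addr0; congr (X s w _ _); apply/val_inj.
- move=> t tT; rewrite (eX t 1 tT) /col2 mxE /= mulr1; congr (_ + _ + _).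
  apply: eq_Rintegral => s _.
  by rewrite mxE !big_ord_recl big_ord0 !mxE /= mul0r !addr0 mulN1r.
Qed.

Definition error_mean (N : nat) : R :=
  (beta_matrix beta (T / N%:R) ^+ N *m X0) 0 0 - (X0 0 0 * cos T + X0 1 0 * sin T).

Definition error_std (N : nat) : R :=
  Num.sqrt (alpha ^+ 2 * \sum_(j < N) block_variance T beta N j).

Lemma measurable_beta_error (N : nat) : (0 < N)%N ->
  measurable_fun setT (beta_error T alpha beta X0 W X N).
Proof.
move=> N0; have h0 : 0 < T / N%:R by rewrite divr_gt0 // ltr0n.
have D0 : 1 + beta * (1 - beta) * (T / N%:R) ^+ 2 != 0.
  case/andP: b01 => b0 b1.
  by rewrite gt_eqF // ltr_wpDr // !mulr_ge0 ?sqr_ge0 ?subr_ge0 // ltW.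
rewrite /beta_error; apply: measurable_funB; last first.
  by case: hX => mX _ _; apply: mX; rewrite ltW //= lexx.
under eq_fun do rewrite beta_method_fst //.
apply: measurable_funD => //; apply: measurable_funM => //.
by apply: measurable_sum => j; apply: measurable_funM => //; exact: measurable_increment.
Qed.

(** Each coarse cell is cut into [m.+1] fine ones, so a coarse increment telescopes into fine
    increments with the same weight. The deviations of the resulting sums [S_ m] are square roots of
    Riemann sums for the block variances, while [S_ m] itself tends almost surely to the centred
    error. *)
Lemma beta_error_law (N : nat) : (0 < N)%N -> forall A : set R, measurable A ->
  P ((fun w => beta_error T alpha beta X0 W X N w - error_mean N) @^-1` A) =
  scaled_normal (error_std N) A.
Proof.
move=> N0; set h := T / N%:R.
have NR : (0 : R) < N%:R by rewrite ltr0n.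
have h0 : 0 < h by rewrite divr_gt0.
set D := 1 + beta * (1 - beta) * h ^+ 2.
have D0 : D != 0.
  case/andP: b01 => b0 b1.
  by rewrite gt_eqF // ltr_wpDr // !mulr_ge0 ?sqr_ge0 ?subr_ge0 // ltW.
pose g j := noise_kernel beta h D (N - j.+1).
pose dlt m := T / (N * m.+1)%:R.
(* [i %/ m.+1] is the coarse cell that contains the fine cell [i]. *)
pose a m i := alpha * (g (i %/ m.+1)%N - sin (T - i%:R * dlt m)).
pose S_ m w := \sum_(i < N * m.+1) a m i *
  increment W (i%:R * dlt m) (i.+1%:R * dlt m) w.
have dltE m : dlt m = h / m.+1%:R.
  by rewrite /dlt /h natrM invfM mulrA.
have gridE m j r : (j * m.+1 + r)%:R * dlt m = j%:R * h + r%:R * dlt m.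
  by rewrite natrD natrM mulrDl {1}dltE -mulrA; congr (_ + _); rewrite (mulrCA m.+1%:R) divff ?mulr1 // pnatr_eq0.
have divE m j (r : 'I_m.+1) : ((j * m.+1 + r) %/ m.+1 = j)%N.
  by rewrite divnMDl // divn_small ?addn0.
have S_E m w : S_ m w = alpha * (\sum_(j < N) g j *
     increment W (j%:R * h) (j.+1%:R * h) w) -
   \sum_(i < N * m.+1) sin (T - i%:R * dlt m) *
      (alpha * increment W (i%:R * dlt m) (i.+1%:R * dlt m) w).
  rewrite /S_ /a.
  under eq_bigr do rewrite (mulrBr alpha) mulrBl.
  rewrite sumrB; congr (_ - _); last by apply: eq_bigr => i _; ring.
  rewrite (sum_blocks N m.+1 (fun i => alpha * g (i %/ m.+1)%N *
     increment W (i%:R * dlt m) (i.+1%:R * dlt m) w)) mulr_sumr.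
  apply: eq_bigr => j _; rewrite mulrA.
  under eq_bigr => r _ do rewrite divE -addnS !gridE.
  rewrite -mulr_sumr; congr (_ * _); rewrite /increment.
  have := @telescope_sumr R 0 m.+1 (fun r => W (j%:R * h + r%:R * dlt m) w) isT.
  rewrite big_mkord => ->; rewrite mul0r addr0; congr (W _ w - _).
  by rewrite dltE -natr1; field.
apply: (normal_ae_limit (S_ := S_)
  (s_ := fun m => Num.sqrt (\sum_(i < N * m.+1) a m i ^+ 2 * dlt m))).
- move=> m; apply: measurable_sum => i; apply: measurable_funM => //.
  exact: measurable_increment.
- by apply: measurable_funB => //; exact: measurable_beta_error.
- apply: filterS solution_cvg => w path.
  rewrite /beta_error beta_method_fst // /error_mean -/h -/D.
  rewrite (_ : _ - _ = alpha * (\sum_(j < N) g j *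
     increment W (j%:R * h) (j.+1%:R * h) w) -
     (X T w 0 0 - (X0 0 0 * cos T + X0 1 0 * sin T))); last by rewrite /g; ring.
  under eq_fun do rewrite S_E.
  apply: cvgB; first exact: cvg_cst.
  (* [solution_cvg] indexes grids with [n.+1] cells, hence the predecessor; the grids refining the
     coarse one form a subsequence. *)
  have sub : (N * m.+1).-1 @[m --> \oo] --> \oo.
    apply/cvgnyPge => k; near=> m.
    apply: (@leq_trans m); first by near: m; exact: nbhs_infty_ge.
    by rewrite -ltnS prednK ?muln_gt0 ?N0 // leq_pmull.
  have := cvg_comp _ _ sub path.
  apply: cvg_trans; apply: near_eq_cvg; apply: nearW => m /=.
  by rewrite prednK // muln_gt0 N0.
- rewrite /error_std.
  apply: (@continuous_cvg _ _ _ _ _ _ (@Num.sqrt R)); first exact: sqrt_continuous.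
  rewrite mulr_sumr.
  under eq_fun => m do rewrite (sum_blocks N m.+1 (fun i => a m i ^+ 2 * dlt m)).
  apply: cvg_big; first exact: add_continuous.
  move=> j _; rewrite /block_variance -/h -/D -/(g j).
  have jh : j%:R * h <= j.+1%:R * h by rewrite ler_wpM2r ?ltW // ltr_nat.
  have := @riemann_sum_cvg R (kernel_primitive T (g j)) (fun s => (g j - sin (T - s)) ^+ 2)
    (j%:R * h) (j.+1%:R * h) _ jh (is_derive_kernel_primitive T (g j))
    (kernel_lipschitz T (g j)).
  have -> : j.+1%:R * h - j%:R * h = h by rewrite -natr1; ring.
  move=> H; apply: cvg_trans (cvgM (cvg_cst (alpha ^+ 2)) H).
  apply: near_eq_cvg; apply: nearW => m /=.
  rewrite mulr_sumr; apply: eq_bigr => r _.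
  by rewrite /a divE gridE dltE; ring.
- move=> m A mA; apply: (brownian_grid_sum T0 hW) => //.
  by rewrite muln_gt0 N0.
Unshelve. all: by end_near. Qed.

End error_law.

(** An increment of a function whose derivative is a square. It ensures that squaring [error_std]
    gives back the variance. *)
Lemma block_variance_ge0 (R : realType) (T beta : R) (N j : nat) : 0 < T ->
  0 <= block_variance T beta N j.
Proof.
move=> T0; rewrite /block_variance; set h := T / N%:R; set g := noise_kernel _ _ _ _.
have jh : j%:R * h <= j.+1%:R * h by rewrite ler_wpM2r ?ler_nat // divr_ge0 // ltW.
have ck : {within `[j%:R * h, j.+1%:R * h], continuous (kernel_primitive T g)}.
  by apply: derivable_within_continuous => x _; case: (is_derive_kernel_primitive T g x).
have [c _ ->] := MVT_segment jh (fun x _ => is_derive_kernel_primitive T g x) ck.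
by rewrite mulr_ge0 ?sqr_ge0 // subr_ge0.
Qed.

(** Strictness matters, as [normal_law] is meaningful for positive variance only, while [sin_bound]
    is not strict. If [T <= - (cos T * sin T)], squaring and [sin_bound] force [cos T ^+ 2 >= 1], so
    [sin T = 0] and [T <= 0]. *)
Lemma limit_variance_gt0 (R : realType) (T : R) : 0 < T -> 0 < T / 6 + sin (2 * T) / 12.
Proof.
move=> T0; suff : - sin (2 * T) < 2 * T by lra.
have -> : sin (2 * T) = 2 * (cos T * sin T) by rewrite !mulr_natl sin_mulr2n.
have := sin_bound (ltW T0); have := cos2Dsin2 T.
have := cos_max T; rewrite !ler_norml => /andP[c1 c2] cs /andP[s1 s2].
rewrite ltNge; apply/negP => H.
have {}H : T <= - (cos T * sin T) by lra.
have cs1 : T * T <= (cos T * sin T) ^+ 2 by nra.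
have cs2 : (cos T * sin T) ^+ 2 <= cos T ^+ 2 * (T * T).
  by rewrite exprMn ler_wpM2l ?sqr_ge0 //; nra.
have cc : 1 <= cos T ^+ 2.
  have TT : 0 < T * T by rewrite mulr_gt0.
  by rewrite -(ler_pM2r TT) mul1r (le_trans cs1 cs2).
have ss : sin T ^+ 2 <= 0 by lra.
have s0 : sin T = 0.
  by apply/eqP; rewrite -sqrf_eq0 eq_le ss sqr_ge0.
by move: H; rewrite s0 mulr0 oppr0 leNgt T0.
Qed.

(** * Mean, variance expansion and limit law of the error *)

Section conclusion.
Context (R : realType) (d : measure_display) (Omega : measurableType d).
Variables (P : probability Omega R) (alpha T beta : R) (X0 : 'cV[R]_2).
Variables (W : R -> {RV P >-> R}) (X : R -> Omega -> 'cV[R]_2).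
Hypotheses (T0 : 0 < T) (b01 : 0 <= beta <= 1).
Hypotheses (hW : brownian_motion T W) (hX : oscillator_solution T alpha X0 W X).
Local Notation e := (beta_error T alpha beta X0 W X).
Local Notation m := (error_mean T beta X0).
Local Notation V := (fun N w => e N w - m N).

Let mV N : (0 < N)%N -> measurable_fun setT (V N).
Proof.
by move=> N0; apply: measurable_funB => //; apply: measurable_beta_error => //; exact: hX.
Qed.

Let lawV N := beta_error_law T0 b01 hW hX (N := N).

(** The factor [a] serves twice: [a = 1] for the variance, [a = N] for the centring in the limit
    theorem. *)
Lemma expectation_beta_error (a : R) (N : nat) : (0 < N)%N ->
  ('E_P[(fun w => a * e N w)%R] = (a * m N)%:E)%E.
Proof.
move=> N0; rewrite unlock.
transitivity (\int[P]_w ((a * m N)%:E + a%:E * (V N w)%:E))%E.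
  by apply: eq_integral => w _; rewrite -EFinM -EFinD; congr EFin; ring.
have iV := scaled_normal_integrable (mV N0) (lawV N0).
rewrite integralD //; last 2 first.
- exact: finite_measure_integrable_cst.
- exact: integrableZl.
rewrite integralZl // (scaled_normal_mean (mV N0) (lawV N0)) mule0 adde0.
by rewrite integral_cst //= [X in (_ * X)%E](@probability_setT _ _ _ P) mule1.
Qed.

Lemma variance_beta_error (N : nat) : (0 < N)%N ->
  ('V_P[e N] = (alpha ^+ 2 * \sum_(j < N) block_variance T beta N j)%:E)%E.
Proof.
move=> N0; rewrite /variance covariance.unlock.
have -> : ('E_P[e N] = (m N)%:E)%E.
  have := expectation_beta_error 1 N0; rewrite mul1r => <-.
  by congr expectation; apply/funext => w; rewrite mul1r.
rewrite unlock.
have := scaled_normal_second_moment (mV N0) (lawV N0).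
rewrite sqr_sqrtr; last first.
  by rewrite mulr_ge0 ?sqr_ge0 // sumr_ge0 // => j _; exact: block_variance_ge0.
by move=> <-; apply: eq_integral => w _; congr EFin.
Qed.

Let v : R := (3 * beta ^+ 2 - 3 * beta + 1) * (T / 6 + sin (2 * T) / 12).

Let hsmall : \forall N \near \oo, (0 < N)%N /\ T / N%:R <= 1.
Proof.
near=> N; have N0 : (0 < N)%N by near: N; exact: nbhs_infty_gt.
split => //; rewrite ler_pdivrMr ?ltr0n // mul1r; near: N; exact: nbhs_infty_ger.
Unshelve. all: by end_near. Qed.

Lemma variance_expansion : exists C : R, \forall N \near \oo,
  (`| 'V_P[e N] - (alpha ^+ 2 * v * (T / N%:R) ^+ 2)%:E | <= (C * (T / N%:R) ^+ 3)%:E)%E.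
Proof.
have [C HC] := variance_error T0 b01.
exists (alpha ^+ 2 * C); near=> N.
have [N0 h1] : (0 < N)%N /\ T / N%:R <= 1 by near: N; exact: hsmall.
rewrite variance_beta_error // -EFinB lee_fin.
rewrite -!(mulrA (alpha ^+ 2)) -mulrBr normrM (ger0_norm (sqr_ge0 alpha)).
by rewrite ler_wpM2l ?sqr_ge0 //; exact: (HC N N0 h1).
Unshelve. all: by end_near. Qed.

Lemma scaled_std_cvg :
  N%:R * error_std alpha T beta N @[N --> \oo] --> Num.sqrt (alpha ^+ 2 * T ^+ 2 * v).
Proof.
have [C HC] := variance_error T0 b01.
pose S N := \sum_(j < N) block_variance T beta N j.
apply: cvg_trans (_ : Num.sqrt (alpha ^+ 2 * N%:R ^+ 2 * S N) @[N --> \oo] --> _).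
  apply: near_eq_cvg; apply: nearW => N.
  rewrite /error_std -/(S N) -[N%:R in RHS](ger0_norm (ler0n _ _)) -sqrtr_sqr -sqrtrM ?sqr_ge0 //.
  by congr Num.sqrt; ring.
apply: (@continuous_cvg _ _ _ _ _ _ (@Num.sqrt R)); first exact: sqrt_continuous.
apply/cvgrPdist_le => eps eps0; near=> N.
have [N0 h1] : (0 < N)%N /\ T / N%:R <= 1 by near: N; exact: hsmall.
have NR : (0 : R) < N%:R by rewrite ltr0n.
have NN0 : N%:R != 0 :> R by rewrite gt_eqF.
have -> : alpha ^+ 2 * T ^+ 2 * v - alpha ^+ 2 * N%:R ^+ 2 * S N =
  - (alpha ^+ 2 * N%:R ^+ 2) * (S N - v * (T / N%:R) ^+ 2) by field.
rewrite normrM normrN (ger0_norm (_ : 0 <= alpha ^+ 2 * N%:R ^+ 2)); last first.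
  by rewrite mulr_ge0 ?sqr_ge0.
(* The factor [N ^ 2] cancels two powers of [T / N], leaving a remainder of order [1 / N]. *)
apply: (@le_trans _ _ (alpha ^+ 2 * N%:R ^+ 2 * (C * (T / N%:R) ^+ 3))).
  by apply: ler_wpM2l; [rewrite mulr_ge0 ?sqr_ge0|exact: (HC N N0 h1)].
have -> : alpha ^+ 2 * N%:R ^+ 2 * (C * (T / N%:R) ^+ 3) = alpha ^+ 2 * C * T ^+ 3 / N%:R.
  by field.
rewrite ler_pdivrMr // [leRHS]mulrC -ler_pdivrMr //.
by near: N; exact: nbhs_infty_ger.
Unshelve. all: by end_near. Qed.

(** Each centred error is an exact scaled normal, so the expectation of [f] is an integral against
    the standard normal with factor [N * error_std]; only [scaled_std_cvg] remains to be used. *)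
Lemma beta_error_cvg_normal : alpha != 0 ->
  cvg_in_distribution P
    (fun N w => N%:R * e N w - fine 'E_P[fun w' => N%:R * e N w'])
    (normal_law 0 (alpha ^+ 2 * T ^+ 2 * v)).
Proof.
move=> al0 f cf [M fM].
have v0 : 0 < v.
  (* [3 * beta ^+ 2 - 3 * beta + 1] equals [3 * (beta - 1 / 2) ^+ 2 + 1 / 4]. *)
  by rewrite mulr_gt0 ?limit_variance_gt0 //; have := sqr_ge0 (beta - 2^-1); nra.
have s0 : 0 < Num.sqrt (alpha ^+ 2 * T ^+ 2 * v).
  by rewrite sqrtr_gt0; apply: mulr_gt0 => //; apply: mulr_gt0; rewrite exprn_even_gt0 //= gt_eqF.
have mf : measurable_fun [set: R] f by exact: continuous_measurable_fun.
have mscale (k : R) : measurable_fun [set: measurableTypeR R] (fun x : measurableTypeR R => k * x).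
  exact: measurable_funM.
rewrite (_ : integral _ _ _ =
  (\int[normal_prob 0 1]_x (f (Num.sqrt (alpha ^+ 2 * T ^+ 2 * v) * x))%:E)%E); last first.
  apply: (@integral_law_eq R _ _ (measurableTypeR R) (measurableTypeR R)
    (normal_law 0 (alpha ^+ 2 * T ^+ 2 * v)) (normal_prob 0 1) id
    (fun x => Num.sqrt (alpha ^+ 2 * T ^+ 2 * v) * x) _ (mscale _) _ (EFin \o f)) => //.
  - by move=> A mA; exact: (scaled_normalE s0 mA).
  - exact/measurable_EFinP.
apply: cvg_trans (cvg_integral_scaled cf fM scaled_std_cvg).
apply: near_eq_cvg; near=> N.
have [N0 h1] : (0 < N)%N /\ T / N%:R <= 1 by near: N; exact: hsmall.
rewrite expectation_beta_error //= unlock.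
transitivity (\int[P]_w ((fun x => (f (N%:R * x))%:E) (V N w)))%E; last first.
  by apply: eq_integral => w _ /=; rewrite mulrBr.
symmetry.
rewrite (@integral_law_eq R _ _ Omega (measurableTypeR R) P (normal_prob 0 1)
  (V N) (fun x => error_std alpha T beta N * x) (mV N0) (mscale _) (lawV N0)
  (fun x => (f (N%:R * x))%:E)).
  by apply: eq_integral => x _; rewrite mulrA.
apply/measurable_EFinP; apply: (measurableT_comp mf).
exact: measurable_funM.
Unshelve. all: by end_near. Qed.

End conclusion.

Theorem mainTheorem4 (R : realType) (d : measure_display)
    (Omega : measurableType d) (P : probability Omega R)
    (alpha T beta : R) (X0 : 'cV[R]_2)
    (W : R -> {RV P >-> R}) (X : R -> Omega -> 'cV[R]_2)
    (halpha : 0 < alpha) (hT : 0 < T)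
    (hbeta : 0 <= beta <= 1)
    (hbeta1 : beta != 1 / 2 - Num.sqrt 6 / 6)
    (hbeta2 : beta != 1 / 2 + Num.sqrt 6 / 6)
    (hW : brownian_motion T W)
    (hX : oscillator_solution T alpha X0 W X) :
  let e := beta_error T alpha beta X0 W X in
  (exists C : R, \forall N \near \oo,
    let h := T / N%:R in
    (`| 'V_P[e N]
        - ((3 * beta ^+ 2 - 3 * beta + 1)
           * (alpha ^+ 2 / 6 * T + alpha ^+ 2 / 12 * sin (2 * T))
           * h ^+ 2)%R%:E |
      <= (C * h ^+ 3)%R%:E)%E) /\
  cvg_in_distribution P
    (fun N w => N%:R * e N w - fine 'E_P[fun w' => N%:R * e N w'])
    (normal_law 0 (alpha ^+ 2 * T ^+ 2 * (3 * beta ^+ 2 - 3 * beta + 1)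
                   * (T / 6 + sin (2 * T) / 12))).
Proof.
split.
  have [C HC] := variance_expansion hT hbeta hW hX.
  exists C; apply: filterS HC => N; congr (`| _ - _%:E | <= _)%E => /=.
  by congr (_ * _); field.
rewrite -[_ * _ * (T / 6 + _)]mulrA.
by apply: beta_error_cvg_normal => //; rewrite gt_eqF.
Qed.
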